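(* Let $\lambda>0$, $a\in\mathbb R$. The gradient of $\mathcal L$ with respect to $H^1_{\lambda,a}$ at $\gamma\in W^{1,1}_{\mathrm{Imm}}(\mathbb S,\mathbb R^2)$ is given by $$\nabla\mathcal L_{\lambda,a}(\gamma)(u)=\frac{\mathcal L(\gamma)^{a-2}}{\lambda^2}\left(\gamma(u)+(\gamma*_\gamma\mathcal G^\lambda)(u)\right),$$ where $\mathcal G^\lambda:\mathbb S\to\mathbb R$ is the 1-periodic extension of $$\mathcal G^\lambda(x)=-\frac{\cosh\left(\frac{|x|-1/2}{\lambda}\right)}{2\lambda\sinh\left(\frac1{2\lambda}\right)},\qquad x\in[0,1],$$ and the $\gamma$-convolution is defined by $$(f*_\gamma\mathcal G^\lambda)(u)=\int_0^1f(v)\,\mathcal G^\lambda(\rho_\gamma(v)-\rho_\gamma(u))\,\frac{|\gamma'(v)|}{\mathcal L(\gamma)}\,dv .$$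
   Context: $\mathbb S=[0,1]/\{0\sim1\}$ is the circle; $|\cdot|$ and $\langle\cdot,\cdot\rangle$ are the Euclidean norm and inner product on $\mathbb R^2$. $W^{1,1}_{\mathrm{Imm}}(\mathbb S,\mathbb R^2)=\{\gamma\in W^{1,1}(\mathbb S,\mathbb R^2): |\gamma'(u)|>0\text{ for a.e. }u\}$. Length: $\mathcal L(\gamma)=\int_0^1|\gamma'(u)|\,du$, and $\rho_\gamma(u)=\frac1{\mathcal L(\gamma)}\int_0^u|\gamma'(\tau)|\,d\tau$. At $\gamma\in W^{1,1}_{\mathrm{Imm}}$ the length is Gâteaux differentiable with $D\mathcal L(\gamma)v=\int_0^1\frac{\langle\gamma'(u),v'(u)\rangle}{|\gamma'(u)|}\,du$ for $v\in W^{1,1}(\mathbb S,\mathbb R^2)$. The $H^1_{\lambda,a}$ metric is $$\langle v,w\rangle_{H^1_{\lambda,a}(\gamma)}=\frac1{\mathcal L(\gamma)^a}\int_0^1\langle v,w\rangle\,|\gamma'|\,du+\frac{\lambda^2}{\mathcal L(\gamma)^{a-2}}\int_0^1\left\langle\frac{v'}{|\gamma'|},\frac{w'}{|\gamma'|}\right\rangle|\gamma'|\,du .$$ The gradient $\nabla\mathcal L_{\lambda,a}(\gamma)$ is the map $\mathbb S\to\mathbb R^2$ determined by $D\mathcal L(\gamma)v=\langle\nabla\mathcal L_{\lambda,a}(\gamma),v\rangle_{H^1_{\lambda,a}(\gamma)}$ for all variations $v\in W^{1,1}(\mathbb S,\mathbb R^2)$. *)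

(* Defs.v *)
From HB Require Import structures.
From mathcomp Require Import all_boot all_order all_algebra.
From mathcomp Require Import all_classical all_reals all_analysis.

Set Implicit Arguments.
Unset Strict Implicit.
Unset Printing Implicit Defensive.

Import Order.TTheory GRing.Theory Num.Theory.
Import numFieldNormedType.Exports.

Local Open Scope classical_set_scope.
Local Open Scope ring_scope.

(* A map on the circle [0,1]/{0~1} is encoded as a function on [R] of which only
   the restriction to [0,1] matters, taking the same value at 0 and 1. *)

(* 'rV_2 carries the sup norm in the library, hence the explicit Euclidean
   structure. *)
Definition dotp {R : realType} (x y : 'rV[R]_2) : R :=
  \sum_(i < 2) x 0 i * y 0 i.

Definition enorm {R : realType} (x : 'rV[R]_2) : R := Num.sqrt (dotp x x).

Definition cosh {R : realType} (x : R) : R := (expR x + expR (- x)) / 2.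

Definition sinh {R : realType} (x : R) : R := (expR x - expR (- x)) / 2.

Definition int01 {R : realType} (f : R -> R) : R :=
  \int[@lebesgue_measure R]_(u in `[0, 1]) f u.

Definition integrable01 {R : realType} (f : R -> R) : Prop :=
  (@lebesgue_measure R).-integrable `[0, 1] (EFin \o f).

(* Elements of C^1(S): differentiability also holds across the point 0 ~ 1. *)
Definition test_function {R : realType} (phi : R -> R) : Prop :=
  [/\ periodic phi 1, forall x, derivable phi x 1 & continuous (derive1 phi)].

(* [g] is an integrable weak derivative of [f] on the circle. *)
Definition is_weak_deriv {R : realType} (f g : R -> R) : Prop :=
  [/\ integrable01 f, integrable01 g &
      forall phi : R -> R, test_function phi ->
        int01 (fun u => f u * derive1 phi u) = - int01 (fun u => g u * phi u)].

(* W^{1,1}(S, R); an element is represented by its continuous representative. *)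
Definition W11 {R : realType} (f : R -> R) : Prop :=
  [/\ {within `[0, 1], continuous f}, f 0 = f 1 &
      exists g : R -> R, is_weak_deriv f g].

(* A weak derivative is unique only almost everywhere: one is chosen. *)
Definition weak_deriv {R : realType} (f : R -> R) : R -> R :=
  xget (cst 0) [set g | is_weak_deriv f g].

Definition curveW11 {R : realType} (gamma : R -> 'rV[R]_2) : Prop :=
  forall i : 'I_2, W11 (fun u => gamma u 0 i).

Definition cderiv {R : realType} (gamma : R -> 'rV[R]_2) (u : R) : 'rV[R]_2 :=
  \row_(i < 2) weak_deriv (fun x => gamma x 0 i) u.

Definition curveImm {R : realType} (gamma : R -> 'rV[R]_2) : Prop :=
  curveW11 gamma /\
  {ae @lebesgue_measure R,
    forall u, u \in `[0, 1] -> 0 < enorm (cderiv gamma u)}.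

Definition clength {R : realType} (gamma : R -> 'rV[R]_2) : R :=
  int01 (fun u => enorm (cderiv gamma u)).

(* Meaningful for [u] in [0,1]. *)
Definition rho {R : realType} (gamma : R -> 'rV[R]_2) (u : R) : R :=
  (clength gamma)^-1 *
  \int[@lebesgue_measure R]_(tau in `[0, u]) enorm (cderiv gamma tau).

(* Integrands of the zeroth and first order terms of the metric. *)
Definition H1_density0 {R : realType} (gamma v w : R -> 'rV[R]_2) (u : R) : R :=
  dotp (v u) (w u) * enorm (cderiv gamma u).

Definition H1_density1 {R : realType} (gamma v w : R -> 'rV[R]_2) (u : R) : R :=
  dotp ((enorm (cderiv gamma u))^-1 *: cderiv v u)
       ((enorm (cderiv gamma u))^-1 *: cderiv w u)
  * enorm (cderiv gamma u).

Definition H1_metric {R : realType} (lambda a : R)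
    (gamma v w : R -> 'rV[R]_2) : R :=
  (clength gamma `^ a)^-1 * int01 (H1_density0 gamma v w) +
  lambda ^+ 2 / clength gamma `^ (a - 2) * int01 (H1_density1 gamma v w).

(* On W^{1,1} the integrals in the metric need not converge. *)
Definition H1_metric_defined {R : realType} (gamma v w : R -> 'rV[R]_2) : Prop :=
  integrable01 (H1_density0 gamma v w) /\
  integrable01 (H1_density1 gamma v w).

(* The Gateaux derivative of the length at [gamma] in every direction [v] of
   W^{1,1} exists and is represented by [h] in the metric. *)
Definition is_length_gradient {R : realType} (lambda a : R)
    (gamma h : R -> 'rV[R]_2) : Prop :=
  curveW11 h /\
  forall v : R -> 'rV[R]_2, curveW11 v ->
    H1_metric_defined gamma h v /\
    is_derive (0 : R) (1 : R)
      (fun t : R => clength (fun u => gamma u + t *: v u))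
      (H1_metric lambda a gamma h v).

Definition kernelG0 {R : realType} (lambda x : R) : R :=
  - (cosh ((`|x| - 1 / 2) / lambda) / (2 * lambda * sinh (1 / (2 * lambda)))).

(* 1-periodic extension of [kernelG0 lambda] from [0,1]. *)
Definition kernelG {R : realType} (lambda x : R) : R :=
  kernelG0 lambda (x - (Num.floor x)%:~R).

Definition gamma_conv {R : realType} (gamma f : R -> 'rV[R]_2) (G : R -> R)
    (u : R) : 'rV[R]_2 :=
  \row_(i < 2) int01 (fun v =>
    f v 0 i * G (rho gamma v - rho gamma u) *
    (enorm (cderiv gamma v) / clength gamma)).

Definition length_gradient_formula {R : realType} (lambda a : R)
    (gamma : R -> 'rV[R]_2) (u : R) : 'rV[R]_2 :=
  (clength gamma `^ (a - 2) / lambda ^+ 2) *: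
  (gamma u + gamma_conv gamma gamma (kernelG lambda) u).

(* Main.v *)
Require Import Defs.
From HB Require Import structures.
From mathcomp Require Import all_boot all_order all_algebra.
From mathcomp Require Import all_classical all_reals all_analysis.
From mathcomp Require Import measurable_realfun.
From mathcomp Require Import ring lra.

(** The formula for the gradient is the solution of a linear second order
    equation on the circle.  In the direction [v], the derivative of the length
    is the integral of [<gamma', v'> / |gamma'|]
    ([clength_is_derive], by dominated convergence).  Writing [h] for the
    gradient and passing to the normalized arc length [s = rho gamma u],
    integration by parts turns the defining identity into
    [h - lambda ^ 2 h'' = - L ^ (a - 2) gamma''], derivatives being taken in
    [s].  Up to the factor [C = L ^ (a - 2) / lambda ^ 2], the solution is
    [gamma + k] where [lambda ^ 2 k'' = k + gamma], and the periodic Green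
    function of this equation is the hyperbolic cosine kernel: its derivative
    jumps by [1 / lambda ^ 2] at 0.

    The arc length is only absolutely continuous, so no change of variables is
    made.  Everything is formulated with Lebesgue primitives on [[0, 1]]
    ([primitive_of]): the equation for [k] becomes a first order system
    [k' = m rho'], [m' = (k + gamma) / lambda ^ 2 rho'] ([green_solution]),
    which is verified by splitting the kernel into exponentials of [rho]
    ([kernelG0_expR]) and applying the product rule and the chain rule for the
    exponential ([primitiveM], [primitive_expR]).  Both rules follow from one
    principle, [quadratic_increments_cst]: a function whose increments are
    bounded by the squared increments of a continuous function is constant.

    The space W^{1,1} is defined by testing against periodic C^1 functions.
    It is matched with primitives by the du Bois-Reymond lemma
    ([weak_deriv_primitive]), whose proof tests only with a constant and with
    the periodic antiderivative of the function to be shown constant, less its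
    mean.  The identity between the metric and the derivative of the length is
    [length_gradient_formula_metric].  Uniqueness holds because the difference
    of two gradients is itself an admissible direction, in which its squared
    norm vanishes ([length_gradient_unique]). *)

Set Implicit Arguments.
Unset Strict Implicit.
Unset Printing Implicit Defensive.

Import Order.TTheory GRing.Theory Num.Theory.
Import numFieldNormedType.Exports.

Local Open Scope classical_set_scope.
Local Open Scope ring_scope.

Local Notation mu := (@lebesgue_measure _).
Local Notation ae01 P := {ae mu, forall u, u \in `[0, 1] -> P u}.
Local Notation meas01 f :=
  (measurable_fun (`[0, 1]%classic : set (measurableTypeR _)) f).
Local Notation itg a b f := (\int[mu]_(t in `[a%R, b%R]) f t).

(** * Integration on the unit interval *)

Lemma ae01S {R : realType} (P Q : R -> Prop) :
  (forall u : R, u \in `[0, 1] -> P u -> Q u) -> ae01 P -> ae01 Q.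
Proof.
move=> PQ [N [mN N0 sN]]; exists N; split => // u /= nQ; apply: sN => /= Pu.
by apply: nQ => u01; exact: PQ (Pu u01).
Qed.

Lemma ae01I {R : realType} (P Q : R -> Prop) :
  ae01 P -> ae01 Q -> ae01 (fun u => P u /\ Q u).
Proof.
move=> [M [mM M0 sM]] [N [mN N0 sN]]; exists (M `|` N); split.
- exact: measurableU.
- exact: null_set_setU.
- move=> u /= nPQ; apply: contrapT => /not_orP[uM uN]; apply: nPQ => u01; split.
    by apply: contrapT => nP; apply: uM; apply: sM => /= /(_ u01).
  by apply: contrapT => nQ; apply: uN; apply: sN => /= /(_ u01).
Qed.

Lemma integrable01_meas {R : realType} (f : R -> R) :
  integrable01 f -> meas01 f.
Proof. by move/(measurable_int mu)/measurable_EFinP. Qed.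

Lemma integrable01D {R : realType} (f g : R -> R) :
  integrable01 f -> integrable01 g -> integrable01 (fun u => f u + g u).
Proof. by move=> fi gi; exact: (integrableD _ fi gi). Qed.

Lemma integrable01B {R : realType} (f g : R -> R) :
  integrable01 f -> integrable01 g -> integrable01 (fun u => f u - g u).
Proof. by move=> fi gi; exact: (integrableB _ fi gi). Qed.

Lemma integrable01Zl {R : realType} (k : R) (f : R -> R) :
  integrable01 f -> integrable01 (fun u => k * f u).
Proof. by move=> fi; exact: (integrableZl _ k fi). Qed.

Lemma integrable01_norm {R : realType} (f : R -> R) :
  integrable01 f -> integrable01 (fun u => `|f u|).
Proof. by move=> fi; exact: (integrable_norm fi). Qed.

Lemma integrable01_le {R : realType} (f g : R -> R) : meas01 f ->
  (forall u : R, u \in `[0, 1] -> `|f u| <= g u) -> integrable01 g -> integrable01 f.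
Proof.
move=> mf fg; apply: le_integrable => //; first exact/measurable_EFinP.
by move=> x /fg fx /=; rewrite lee_fin (le_trans fx)// ler_norm.
Qed.

Lemma integrable01_bounded {R : realType} (M : R) (h g : R -> R) : meas01 h ->
  (forall u : R, u \in `[0, 1] -> `|h u| <= M) -> integrable01 g ->
  integrable01 (fun u => h u * g u).
Proof.
move=> mh hM gi; apply: (@integrable01_le _ _ (fun u => M * `|g u|)).
- by apply: measurable_funM => //; exact: integrable01_meas.
- by move=> u u01; rewrite normrM ler_wpM2r// hM.
- exact/integrable01Zl/integrable01_norm.
Qed.

Lemma continuous01_meas {R : realType} (f : R -> R) :
  {within `[0, 1], continuous f} -> meas01 f.
Proof. by move=> cf; exact: subspace_continuous_measurable_fun. Qed.

Lemma continuous01_bounded {R : realType} (f : R -> R) :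
  {within `[0, 1], continuous f} ->
  exists2 M : R, 0 <= M & forall u : R, u \in `[0, 1] -> `|f u| <= M.
Proof.
move=> cf.
have cnf : {within `[0, 1], continuous (fun u => `|f u|)}.
  by move=> x; apply: cvg_norm; exact: cf.
have [c c01 fc] := EVT_max ler01 cnf.
by exists `|f c|.
Qed.

Lemma integrable01_continuousM {R : realType} (f g : R -> R) :
  {within `[0, 1], continuous f} -> integrable01 g ->
  integrable01 (fun u => f u * g u).
Proof.
move=> cf gi; have [M _ fM] := continuous01_bounded cf.
by apply: (integrable01_bounded _ fM) => //; exact: continuous01_meas.
Qed.

Lemma integrable01_cst {R : realType} (c : R) : integrable01 (fun=> c).
Proof.
apply: continuous_compact_integrable; first exact: segment_compact.
by move=> ?; exact: cvg_cst.
Qed.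

Lemma integrable01_continuous {R : realType} (f : R -> R) :
  {within `[0, 1], continuous f} -> integrable01 f.
Proof. by apply: continuous_compact_integrable; exact: segment_compact. Qed.

(** The measurability of [f] cannot be inferred from that of [g]: measurability
    is Borel measurability, which is not stable under almost everywhere
    equality. *)
Lemma integrable01_ae {R : realType} (f g : R -> R) :
  meas01 f -> ae01 (fun u => f u = g u) -> integrable01 g -> integrable01 f.
Proof.
move=> mf fg gi; have mg := integrable01_meas gi.
move/integrableP : gi => [mg' goo]; apply/integrableP.
split; first exact/measurable_EFinP.
rewrite [ltLHS](_ : _ = \int[mu]_(u in `[0%R, 1%R]) `|(EFin \o g) u|)%E//.
apply: ae_eq_integral => //.
- by apply: measurableT_comp => //; exact/measurable_EFinP.
- by apply: measurableT_comp => //; exact/measurable_EFinP.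
- by apply: ae01S fg => u _ /= ->.
Qed.

Lemma int01_ae {R : realType} (f g : R -> R) : meas01 f -> meas01 g ->
  ae01 (fun u => f u = g u) -> int01 f = int01 g.
Proof.
move=> mf mg fg; rewrite /int01 /Rintegral; congr fine.
apply: ae_eq_integral => //; try exact/measurable_EFinP.
by apply: ae01S fg => u _ /= ->.
Qed.

Lemma eq_int01 {R : realType} (f g : R -> R) :
  (forall u : R, u \in `[0, 1] -> f u = g u) -> int01 f = int01 g.
Proof. by move=> fg; apply: eq_Rintegral => u; rewrite inE => /fg. Qed.

Lemma int01D {R : realType} (f g : R -> R) :
  integrable01 f -> integrable01 g ->
  int01 (fun u => f u + g u) = int01 f + int01 g.
Proof. by move=> fi gi; exact: RintegralD. Qed.

Lemma int01B {R : realType} (f g : R -> R) :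
  integrable01 f -> integrable01 g ->
  int01 (fun u => f u - g u) = int01 f - int01 g.
Proof. by move=> fi gi; exact: RintegralB. Qed.

Lemma int01Zl {R : realType} (k : R) (f : R -> R) : integrable01 f ->
  int01 (fun u => k * f u) = k * int01 f.
Proof. by move=> fi; exact: RintegralZl. Qed.

Lemma int01_sum {R : realType} (n : nat) (f : 'I_n -> R -> R) :
  (forall i, integrable01 (f i)) ->
  integrable01 (fun u => \sum_(i < n) f i u) /\
  int01 (fun u => \sum_(i < n) f i u) = \sum_(i < n) int01 (f i).
Proof.
elim: n f => [|n ih] f fi.
  under eq_fun do rewrite big_ord0; rewrite big_ord0; split.
    exact: integrable01_cst.
  by rewrite /int01 /= Rintegral_cst// mul0r.
under eq_fun do rewrite big_ord_recl.
have [i1 i2] := ih (fun i => f (lift ord0 i)) (fun i => fi _).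
by split; [exact: integrable01D|rewrite int01D// i2 big_ord_recl].
Qed.

Lemma int01_ge0_eq0 {R : realType} (f : R -> R) : integrable01 f ->
  (forall u : R, u \in `[0, 1] -> 0 <= f u) -> int01 f = 0 ->
  ae01 (fun u => f u = 0).
Proof.
move=> fi f0 If.
have mf := integrable01_meas fi.
have /(ae_eq_integral_abs mu) : meas01 (EFin \o f).
  exact/measurable_EFinP.
case=> // + _; case=> //.
  have <- : (\int[mu]_(x in `[0%R, 1%R]) (EFin \o f) x = 0)%E.
    rewrite -[LHS]fineK; first by congr EFin; exact: If.
    exact: integrable_fin_num.
  by apply: eq_integral => u; rewrite inE => /f0 fu; rewrite gee0_abs.
by move=> N h; exists N; case: h => mN N0 sN; split => // u /= hu; apply: sN => /= h2;
  apply: hu => u01; case: (h2 u01).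
Qed.

Lemma int01_cst {R : realType} (c : R) : int01 (fun=> c) = c.
Proof.
rewrite /int01 Rintegral_cst//= lebesgue_measure_itv/= lte_fin ltr01.
by rewrite oppr0 adde0 mulr1.
Qed.

(** * Calculus of Lebesgue primitives *)

Lemma subset_itv_cc {R : realType} (a b c d : R) :
  c <= a -> b <= d -> `[a, b]%classic `<=` `[c, d]%classic.
Proof.
move=> ca bd x /=; rewrite !in_itv/= => /andP[ax xb].
by rewrite (le_trans ca ax) (le_trans xb bd).
Qed.

Lemma integrable_itv {R : realType} (a b : R) (f : R -> R) :
  0 <= a -> b <= 1 -> integrable01 f -> mu.-integrable `[a, b] (EFin \o f).
Proof.
by move=> a0 b1; apply: integrableS => //; exact: subset_itv_cc.
Qed.

Lemma itg_split {R : realType} (a b : R) (f : R -> R) :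
  0 <= a -> a <= b -> b <= 1 -> integrable01 f ->
  itg 0 b f = itg 0 a f + itg a b f.
Proof.
move=> a0 ab b1 fi.
have f0b := integrable_itv (lexx 0) b1 fi.
rewrite -[itg a b f]Rintegral_itv_obnd_cbnd; last first.
  apply: integrableS (integrable_itv a0 b1 fi) => //.
  exact: subset_itv_oc_cc.
by rewrite -(Rintegral_itvB f0b) ?bnd_simp// addrC subrK.
Qed.

Lemma norm_itg_le {R : realType} (a b M : R) (f w : R -> R) :
  0 <= a -> a <= b -> b <= 1 -> integrable01 f -> integrable01 w ->
  (forall t : R, t \in `[a, b] -> `|f t| <= M * w t) ->
  `|itg a b f| <= M * itg a b w.
Proof.
move=> a0 ab b1 fi wi fw.
have fi' := integrable_itv a0 b1 fi; have wi' := integrable_itv a0 b1 wi.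
apply: (le_trans (le_normr_Rintegral _ _)) => //.
rewrite -RintegralZl//; apply: le_Rintegral => //.
- exact: integrable_norm.
- exact: (integrableZl _ M wi').
Qed.

Lemma eq0_of_geometric_bound {R : realType} (x C : R) :
  0 <= C -> (forall n, `|x| <= C / 2 ^+ n) -> x = 0.
Proof.
move=> C0 xC; apply/eqP; rewrite -normr_eq0; apply: contraT => x0.
have xp : 0 < `|x| by rewrite lt_def x0 normr_ge0.
have /archi_boundP : 0 <= C / `|x| by rewrite divr_ge0.
set n := Num.bound _; rewrite ltr_pdivrMr// => Cn.
have := xC n; rewrite ler_pdivlMr ?exprn_gt0// leNgt => /negP[].
apply: (lt_le_trans Cn); rewrite mulrC ler_wpM2l// -natrX ler_nat.
exact/ltnW/ltn_expl.
Qed.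

(** By the intermediate value theorem the variation of [W] over [[a, b]] can be
    halved at some intermediate point, and halving it divides the quadratic
    bound by 4 on each of the two pieces, hence by 2 in total.  Iterating, the
    bound tends to 0.  This is the argument that a map with quadratic
    increments is constant, run in the parameter [W] instead of [u]; it makes
    calculus rules for Lebesgue primitives accessible without Fubini and
    without almost everywhere differentiation. *)
Lemma quadratic_increments_cst {R : realType} (D W : R -> R) (M : R) :
  {within `[0, 1], continuous W} -> 0 <= M ->
  (forall a b : R, 0 <= a -> a <= b -> b <= 1 ->
     `|D b - D a| <= M * (W b - W a) ^+ 2) ->
  forall u : R, u \in `[0, 1] -> D u = D 0.
Proof.
move=> cW M0 DW u; rewrite in_itv/= => /andP[u0 u1].
have H n : forall a b : R, 0 <= a -> a <= b -> b <= 1 ->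
     `|D b - D a| <= M * (W b - W a) ^+ 2 / 2 ^+ n.
  elim: n => [|n ih] a b a0 ab b1; first by rewrite expr0 divr1 DW.
  have cWab : {within `[a, b], continuous W}.
    by apply: continuous_subspaceW cW; exact: subset_itv_cc.
  have [|m] := IVT ab cWab (v := (W a + W b) / 2).
    by case: (lerP (W a) (W b)) => h; lra.
  rewrite in_itv/= => /andP[am mb] Wm.
  have -> : D b - D a = (D b - D m) + (D m - D a) by ring.
  apply: (le_trans (ler_normD _ _)).
  have h1 := ih _ _ a0 am (le_trans mb b1).
  have h2 := ih _ _ (le_trans a0 am) mb b1.
  apply: (le_trans (lerD h2 h1)); rewrite Wm (exprS 2 n).
  have : (2 ^+ n : R) != 0 by rewrite expf_neq0.
  move: (2 ^+ n) => p p0.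
  rewrite le_eqVlt; apply/orP; left; apply/eqP; by field.
apply: subr0_eq; apply: (@eq0_of_geometric_bound _ _ (M * (W u - W 0) ^+ 2)).
  by rewrite mulr_ge0// sqr_ge0.
by move=> n; exact: H.
Qed.

(** Absolute continuity of [F] on [[0, 1]], with [f] as derivative almost
    everywhere, in the integral form in which it is used. *)
Definition primitive_of {R : realType} (F f : R -> R) : Prop :=
  integrable01 f /\ forall u : R, u \in `[0, 1] -> F u = F 0 + itg 0 u f.

Lemma primitive_incr {R : realType} (F f : R -> R) (a b : R) :
  primitive_of F f -> 0 <= a -> a <= b -> b <= 1 -> F b - F a = itg a b f.
Proof.
move=> [fi Ff] a0 ab b1; rewrite (Ff b) ?(Ff a) ?in_itv/=; last 2 first.
- by rewrite a0 (le_trans ab).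
- by rewrite b1 (le_trans a0).
by rewrite (itg_split a0 ab b1 fi); ring.
Qed.

Lemma primitive_itg {R : realType} (f : R -> R) (c : R) :
  integrable01 f -> primitive_of (fun u => c + itg 0 u f) f.
Proof.
by move=> fi; split=> // u _; rewrite set_itv1 Rintegral_set1 addr0.
Qed.

Lemma continuous01_ext {R : realType} (f g : R -> R) :
  (forall u : R, u \in `[0, 1] -> f u = g u) ->
  {within `[0, 1], continuous f} -> {within `[0, 1], continuous g}.
Proof. by move=> fg; apply: subspace_eq_continuous => u; rewrite inE; exact: fg. Qed.

Lemma primitive_continuous {R : realType} (F f : R -> R) :
  primitive_of F f -> {within `[0, 1], continuous F}.
Proof.
move=> [fi Ff].
have cI : {within `[0, 1], continuous (fun u => F 0 + itg 0 u f)}.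
  move=> u; apply: cvgD; first exact: cvg_cst.
  exact: (parameterized_integral_continuous ler01 fi).
apply: (continuous01_ext _ cI) => u u01; exact/esym/Ff.
Qed.

Lemma primitiveD {R : realType} (F G f g : R -> R) :
  primitive_of F f -> primitive_of G g ->
  primitive_of (fun u => F u + G u) (fun u => f u + g u).
Proof.
move=> [fi Ff] [gi Gg]; split; first exact: integrable01D.
move=> u u01; rewrite (Ff _ u01) (Gg _ u01).
move: u01; rewrite in_itv/= => /andP[u0 u1].
rewrite RintegralD//; [by ring|exact: integrable_itv..].
Qed.

Lemma primitiveZ {R : realType} (c : R) (F f : R -> R) :
  primitive_of F f -> primitive_of (fun u => c * F u) (fun u => c * f u).
Proof.
move=> [fi Ff]; split; first exact: integrable01Zl.
move=> u u01; rewrite (Ff _ u01).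
move: u01; rewrite in_itv/= => /andP[u0 u1].
rewrite RintegralZl//; [by ring|exact: integrable_itv].
Qed.

Lemma primitive_cst {R : realType} (c : R) : primitive_of (fun=> c) (fun=> 0).
Proof.
split; first exact: integrable01_cst.
by move=> u _; rewrite Rintegral_cst// mul0r addr0.
Qed.

Lemma primitive_ext {R : realType} (F G f g : R -> R) :
  (forall u : R, u \in `[0, 1] -> F u = G u) ->
  (forall u : R, u \in `[0, 1] -> f u = g u) ->
  primitive_of F f -> primitive_of G g.
Proof.
move=> FG fg [fi Ff]; split.
  by apply: eq_integrable fi => // u; rewrite inE => /fg /= ->.
move=> u u01; rewrite -FG// -FG ?in_itv/= ?lexx ?ler01// Ff//; congr (_ + _).
apply: eq_Rintegral => t; rewrite inE/= in_itv/= => /andP[t0 tu].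
by apply: fg; move: u01; rewrite !in_itv/= t0 => /andP[_]; exact: le_trans.
Qed.

Lemma primitive_incr_le {R : realType} (F f W w : R -> R) (a t b : R) :
  primitive_of F f -> primitive_of W w ->
  (forall u : R, u \in `[0, 1] -> `|f u| <= w u) ->
  0 <= a -> t \in `[a, b] -> b <= 1 -> `|F t - F a| <= W b - W a.
Proof.
move=> Ff Ww fw a0; rewrite in_itv/= => /andP[a_t tb] b1.
have t1 := le_trans tb b1; have t0 := le_trans a0 a_t.
have -> : W b - W a = (W b - W t) + (W t - W a) by ring.
rewrite (primitive_incr Ff)// (primitive_incr Ww t0)// (primitive_incr Ww a0)//.
rewrite -[leLHS]add0r lerD//.
  apply: Rintegral_ge0 => x /=; rewrite in_itv/= => /andP[tx xb].
  by apply: le_trans (fw x _) => //; rewrite in_itv/= (le_trans t0 tx) (le_trans xb).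
rewrite -[leRHS]mul1r; apply: norm_itg_le => //; [exact: Ff.1|exact: Ww.1|].
move=> x; rewrite in_itv/= => /andP[ax xt]; rewrite mul1r; apply: fw.
by rewrite in_itv/= (le_trans a0 ax) (le_trans xt).
Qed.

(** It suffices to check the integral formula up to an error quadratic in the
    increments of an auxiliary primitive [W]: the error is then constant. *)
Lemma primitive_of_quadratic {R : realType} (F f W w : R -> R) (M : R) :
  integrable01 f -> primitive_of W w -> 0 <= M ->
  (forall a b : R, 0 <= a -> a <= b -> b <= 1 ->
     `|F b - F a - itg a b f| <= M * (W b - W a) ^+ 2) ->
  primitive_of F f.
Proof.
move=> fi Ww M0 FW; split=> // u u01.
pose D t := F t - itg 0 t f.
have : D u = D 0.
  apply: (quadratic_increments_cst (primitive_continuous Ww) M0) => // a b a0 ab b1.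
  apply: le_trans (FW a b a0 ab b1); rewrite /D (itg_split a0 ab b1 fi).
  by rewrite le_eqVlt; apply/orP; left; apply/eqP; congr (`|_|); ring.
by rewrite /D set_itv1 Rintegral_set1 subr0 => <-; ring.
Qed.

(** With [W] the primitive of [|f| + |g|], the increments of [F] and [G] are
    bounded by those of [W].  The increment of [F * G] minus the integral of
    [G * f + F * g] is the product of the two increments minus an integral
    of the increments against [f] and [g], all quadratic in [W]. *)
Lemma primitiveM {R : realType} (F G f g : R -> R) :
  primitive_of F f -> primitive_of G g ->
  primitive_of (fun u => F u * G u) (fun u => G u * f u + F u * g u).
Proof.
move=> Ff Gg.
have cF := primitive_continuous Ff; have cG := primitive_continuous Gg.
have fi := Ff.1; have gi := Gg.1.
pose h u := G u * f u + F u * g u.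
have hi : integrable01 h by apply: integrable01D; exact: integrable01_continuousM.
pose w u := `|f u| + `|g u|.
have wi : integrable01 w by apply: integrable01D; exact: integrable01_norm.
pose W u := 0 + itg 0 u w.
have Ww : primitive_of W w by exact: primitive_itg.
apply: (primitive_of_quadratic hi Ww (_ : 0 <= 2)) => // a b a0 ab b1.
have fw (t : R) : t \in `[0, 1] -> `|f t| <= w t by rewrite lerDl.
have gw (t : R) : t \in `[0, 1] -> `|g t| <= w t by rewrite lerDr.
set X := W b - W a.
have XE : X = itg a b w by exact: primitive_incr Ww _ _ _.
have dF (t : R) : t \in `[a, b] -> `|F t - F a| <= X.
  by move=> tab; exact: primitive_incr_le Ff Ww fw a0 tab b1.
have dG (t : R) : t \in `[a, b] -> `|G t - G a| <= X.
  by move=> tab; exact: primitive_incr_le Gg Ww gw a0 tab b1.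
have bab : b \in `[a, b] by rewrite in_itv/= ab lexx.
pose r u := (G u - G a) * f u + (F u - F a) * g u.
have ri : integrable01 r.
  apply: integrable01D; apply: integrable01_continuousM => //.
  - by move=> t; apply: cvgB; [exact: cG|exact: cvg_cst].
  - by move=> t; apply: cvgB; [exact: cF|exact: cvg_cst].
have rX : `|itg a b r| <= X * X.
  rewrite [X in _ * X]XE; apply: norm_itg_le => // t tab.
  apply: (le_trans (ler_normD _ _)); rewrite !normrM mulrDr.
  by apply: lerD; apply: ler_wpM2r => //; [exact: dG|exact: dF].
have hE : itg a b h = itg a b r + G a * (F b - F a) + F a * (G b - G a).
  have I A : integrable01 A -> mu.-integrable `[a, b] (EFin \o A).
    exact: integrable_itv.
  rewrite (primitive_incr Ff)// (primitive_incr Gg)//.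
  rewrite -!RintegralZl//; try exact: I.
  rewrite -RintegralD//; [|exact: I|exact/I/integrable01Zl].
  rewrite -RintegralD//; [|apply/I/integrable01D => //|];
    try exact/I/integrable01Zl; try exact: integrable01Zl.
  by apply: eq_Rintegral => t _; rewrite /h /r; ring.
have -> : F b * G b - F a * G a - itg a b h =
    (F b - F a) * (G b - G a) - itg a b r by rewrite hE; ring.
apply: (le_trans (ler_normB _ _)); rewrite normrM.
have : `|F b - F a| * `|G b - G a| <= X * X.
  by apply: ler_pM => //; [exact: dF|exact: dG].
by rewrite expr2; move: rX; lra.
Qed.

Lemma primitive_by_parts {R : realType} (F G f g : R -> R) :
  primitive_of F f -> primitive_of G g -> F 1 * G 1 = F 0 * G 0 ->
  int01 (fun u => F u * g u) = - int01 (fun u => f u * G u).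
Proof.
move=> Ff Gg FG.
have [_ /(_ 1)] := primitiveM Ff Gg.
rewrite FG in_itv/= ler01 lexx => /(_ isT).
rewrite -[LHS]addr0 => /addrI/esym/eqP; rewrite RintegralD//.
- rewrite addrC addr_eq0 => /eqP E; rewrite [LHS]E; congr (- _).
  by apply: eq_int01 => u _; rewrite mulrC.
- by apply: integrable01_continuousM Ff.1; exact: primitive_continuous Gg.
- by apply: integrable01_continuousM Gg.1; exact: primitive_continuous Ff.
Qed.

Lemma expR_lipschitz {R : realType} (B x y : R) : x <= B -> y <= B ->
  `|expR y - expR x| <= expR B * `|y - x|.
Proof.
wlog xy : x y / x <= y => [H xB yB|xB yB].
  by have [/H|/ltW/H] := leP x y; [exact|rewrite distrC (distrC y); exact].
rewrite !ger0_norm ?subr_ge0 ?ler_expR//.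
have h := expR_ge1Dx (x - y).
have -> : expR x = expR y * expR (x - y) by rewrite -expRD addrC subrK.
have -> : expR y - expR y * expR (x - y) = expR y * (1 - expR (x - y)) by ring.
apply: (@le_trans _ _ (expR y * (y - x))).
  by rewrite ler_wpM2l ?expR_ge0//; lra.
by rewrite ler_wpM2r ?subr_ge0 ?ler_expR.
Qed.

Lemma expR_taylor1 {R : realType} (B x y : R) : x <= B -> y <= B ->
  `|expR y - expR x - expR x * (y - x)| <= expR B * `|y - x| ^+ 2.
Proof.
move=> xB yB.
have h1 : 0 <= expR y - expR x - expR x * (y - x).
  have := expR_ge1Dx (y - x); have := expR_gt0 x.
  have -> : expR y = expR x * expR (y - x) by rewrite -expRD addrC subrK.
  move=> p q; have -> : expR x * expR (y - x) - expR x - expR x * (y - x) =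
    expR x * (expR (y - x) - (1 + (y - x))) by ring.
  by rewrite mulr_ge0 ?expR_ge0// subr_ge0.
have h2 : expR y - expR x <= expR y * (y - x).
  have := expR_ge1Dx (x - y); have := expR_gt0 y.
  have -> : expR x = expR y * expR (x - y) by rewrite -expRD addrC subrK.
  move=> p q; rewrite -subr_ge0.
  have -> : expR y * (y - x) - (expR y - expR y * expR (x - y)) =
    expR y * (expR (x - y) - (1 + (x - y))) by ring.
  by rewrite mulr_ge0 ?expR_ge0// subr_ge0.
rewrite ger0_norm// real_normK ?num_real//.
apply: (@le_trans _ _ ((expR y - expR x) * (y - x))); first lra.
apply: (le_trans (ler_norm _)); rewrite normrM.
apply: (le_trans (ler_wpM2r (normr_ge0 _) (expR_lipschitz xB yB))).
by rewrite -mulrA -expr2 real_normK ?num_real.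
Qed.

(** The chain rule, for the same reason as the product rule: the error is the
    second order Taylor remainder of [expR] and the increment of [expR \o F]
    integrated against [f]. *)
Lemma primitive_expR {R : realType} (F f : R -> R) : primitive_of F f ->
  primitive_of (fun u => expR (F u)) (fun u => expR (F u) * f u).
Proof.
move=> Ff; have cF := primitive_continuous Ff; have fi := Ff.1.
have cE : {within `[0, 1], continuous (fun u => expR (F u))}.
  by move=> u; apply: continuous_comp; [exact: cF|exact: continuous_expR].
have [B _ FB] := continuous01_bounded cF.
have {}FB (u : R) : u \in `[0, 1] -> F u <= B.
  by move=> /FB; exact: le_trans (ler_norm _).
pose W u := 0 + itg 0 u (fun t => `|f t|).
have Ww : primitive_of W (fun u => `|f u|).
  exact/primitive_itg/integrable01_norm.
apply: (primitive_of_quadratic _ Ww (_ : 0 <= 2 * expR B)).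
- exact: integrable01_continuousM.
- by rewrite mulr_ge0 ?expR_ge0.
move=> a b a0 ab b1.
set X := W b - W a.
have dF (t : R) : t \in `[a, b] -> `|F t - F a| <= X.
  by move=> tab; exact: primitive_incr_le Ff Ww _ a0 tab b1.
have XE : X = itg a b (fun u => `|f u|) by exact: primitive_incr Ww _ _ _.
have bab : b \in `[a, b] by rewrite in_itv/= ab lexx.
have a01 : a \in `[0, 1] by rewrite in_itv/= a0 (le_trans ab).
have b01 : b \in `[0, 1] by rewrite in_itv/= b1 (le_trans a0).
have X0 : 0 <= X := le_trans (normr_ge0 _) (dF _ bab).
pose r u := (expR (F u) - expR (F a)) * f u.
have ri : integrable01 r.
  apply: integrable01_continuousM => //.
  by move=> t; apply: cvgB; [exact: cE|exact: cvg_cst].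
have rX : `|itg a b r| <= expR B * X * X.
  rewrite [X in _ * X]XE; apply: norm_itg_le => //.
    exact: integrable01_norm.
  move=> t tab; rewrite normrM ler_wpM2r//.
  apply: (le_trans (expR_lipschitz (FB _ a01) (FB t _))).
    by move: tab; rewrite !in_itv/= => /andP[? ?]; rewrite (le_trans a0) ?(le_trans _ b1).
  by rewrite ler_wpM2l ?expR_ge0// dF.
have -> : itg a b (fun u => expR (F u) * f u) =
    itg a b r + expR (F a) * (F b - F a).
  have I A : integrable01 A -> mu.-integrable `[a, b] (EFin \o A).
    exact: integrable_itv.
  rewrite (primitive_incr Ff)// -RintegralZl//; last exact: I.
  rewrite -RintegralD//; [|exact: I|exact/I/integrable01Zl].
  by apply: eq_Rintegral => t _; rewrite /r; ring.
rewrite opprD [- itg a b r - _]addrC addrA.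
apply: (le_trans (ler_normB _ _)).
have h : expR B * `|F b - F a| ^+ 2 <= expR B * X ^+ 2.
  by rewrite ler_wpM2l ?expR_ge0// ler_sqr ?nnegrE// dF.
have := expR_taylor1 (FB _ a01) (FB _ b01).
rewrite expr2 in h *; move: rX; lra.
Qed.

(** * Weak derivatives on the circle *)

Lemma continuous_clamp {R : realType} (H : R -> R) :
  {within `[0, 1], continuous H} ->
  continuous (fun x : R => H (Num.max 0 (Num.min x 1))).
Proof.
move=> cH x; pose c (y : R) := Num.max 0 (Num.min y 1).
have c01 y : c y \in `[0, 1].
  by rewrite in_itv/= /c le_max lexx ge_max ler01 ge_min lexx orbT.
have cc : {for x, continuous c}.
  have c1 : {for x, continuous (cst 1 : R -> R^o)} by exact: cvg_cst.
  have c0 : {for x, continuous (cst 0 : R -> R^o)} by exact: cvg_cst.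
  have ci : {for x, continuous (id : R -> R^o)} by [].
  exact: (continuous_max c0 (continuous_min ci c1)).
have Hx := cH (c x).
apply: (cvg_comp c H _ Hx).
move=> A. rewrite {1}/nbhs/= /nbhs_subspace mem_set//; last exact: c01.
rewrite /within/= => /cc; rewrite !near_simpl.
by apply: filterS => y /(_ (c01 y)).
Qed.

Lemma frac_periodic {R : realType} (H : R -> R) :
  periodic (fun x : R => H (x - (Num.floor x)%:~R)) 1.
Proof.
by move=> x /=; congr H; rewrite floorDrz// floor1 intrD; ring.
Qed.

Lemma near_floor {R : realType} (x : R) (n := (Num.floor x)%:~R : R) :
  \forall y \near x, n - 1 < y /\ y < n + 1.
Proof.
have := floor_le x; have := floorD1_gt x; rewrite intrD -/n => x1 x0.
near=> y; split; near: y.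
  by apply: lt_nbhsr; lra.
by apply: lt_nbhsl.
Unshelve. all: by end_near. Qed.

Lemma floor_cases {R : realType} (n : int) (y : R) : n%:~R - 1 < y -> y < n%:~R + 1 ->
  (n%:~R <= y /\ Num.floor y = n) \/ (y < n%:~R /\ Num.floor y = n - 1).
Proof.
move=> y0 y1; have [ny|yn] := leP n%:~R y; [left|right]; split=> //; apply: floor_def.
  by rewrite ny intrD.
by rewrite subrK yn andbT intrD ltW.
Qed.

(** Near a point of integral part [n], the periodic extension agrees with the
    sum of the constant extensions of the two adjacent copies of [H], on
    [[n - 1, n]] and on [[n, n + 1]], minus their common value [H 0].  This
    removes the case distinction at the junction. *)
Lemma periodic_extension_continuous {R : realType} (H : R -> R) :
  {within `[0, 1], continuous H} -> H 0 = H 1 ->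
  continuous (fun x : R => H (x - (Num.floor x)%:~R)).
Proof.
move=> cH H01 x; pose Hc (y : R) := H (Num.max 0 (Num.min y 1)).
set n := Num.floor x.
have cHc := continuous_clamp cH.
pose K (y : R) := Hc (y - n%:~R) + Hc (y - n%:~R + 1) - H 0.
have Kx : {for x, continuous K}.
  apply: cvgB; last exact: cvg_cst.
  apply: cvgD.
    apply: (@continuous_comp _ _ _ (fun y : R => y - n%:~R) Hc); last exact: cHc.
    by apply: cvgB => //; exact: cvg_cst.
  apply: (@continuous_comp _ _ _ (fun y : R => y - n%:~R + 1) Hc); last exact: cHc.
  by apply: cvgD; [apply: cvgB => //|]; exact: cvg_cst.
have KE (y : R) : n%:~R - 1 < y -> y < n%:~R + 1 ->
    K y = H (y - (Num.floor y)%:~R).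
  move=> y0 y1; rewrite /K /Hc; case: (floor_cases y0 y1) => -[ny ->].
    rewrite [Num.min (_ + 1) _]min_r; last lra.
    rewrite [Num.max _ 1]max_r// -H01 addrK; congr H.
    by rewrite min_l ?max_r//; lra.
  rewrite [Num.max _ (Num.min (y - _) 1)]max_l; last first.
    by rewrite ge_min; apply/orP; left; lra.
  rewrite [H 0 + _]addrC addrK intrD; congr H.
  rewrite min_l ?max_r//; [ring|lra|lra].
have [x0 x1] : n%:~R - 1 < x /\ x < n%:~R + 1 by exact: nbhs_singleton (near_floor x).
rewrite /continuous_at -(KE x x0 x1).
apply: cvg_trans Kx; apply: near_eq_cvg.
near=> y; have [y0 y1] : n%:~R - 1 < y /\ y < n%:~R + 1.
  by near: y; exact: near_floor.
by rewrite KE.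
Unshelve. all: by end_near. Qed.

Lemma continuous_itg_is_derive {R : realType} (h : R -> R) (a x : R) :
  continuous h -> a < x -> is_derive x 1 (fun y => itg a y h) (h x).
Proof.
move=> ch ax.
have hi : mu.-integrable `[a, x + 1] (EFin \o h).
  apply: continuous_compact_integrable; first exact: segment_compact.
  exact: continuous_subspaceT.
have [dF F'] := continuous_FTC1_closed (ltr_pwDr ltr01 (lexx x)) hi ax (ch x).
by apply: DeriveDef; [exact: dF|rewrite -derive1E F'].
Qed.

(** The zero mean is what makes the antiderivative periodic.  The base point -3
    only has to lie to the left of the fundamental domain and of its translate
    by -1, where derivatives of the integral are taken. *)
Lemma test_function_antiderivative {R : realType} (H : R -> R) :
  {within `[0, 1], continuous H} -> H 0 = H 1 -> int01 H = 0 ->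
  exists2 phi : R -> R, test_function phi &
    forall u : R, u \in `[0, 1] -> derive1 phi u = H u.
Proof.
move=> cH H01 IH; pose Ht x := H (x - (Num.floor x)%:~R).
have cHt : continuous Ht by exact: periodic_extension_continuous.
have HtE (u : R) : u \in `[0, 1] -> Ht u = H u.
  rewrite in_itv/= => /andP[u0]; rewrite le_eqVlt => /predU1P[->|u1].
    by rewrite /Ht floor1 subrr H01.
  by rewrite /Ht (@floor_def _ _ 0) ?subr0// u0.
have Htp : periodic Ht 1 by exact: frac_periodic.
pose Phi x := itg (-3) x Ht.
have dPhi (x : R) : -3 < x -> is_derive x 1 Phi (Ht x).
  exact: continuous_itg_is_derive.
have Phi01 : Phi 1 = Phi 0.
  have i31 : mu.-integrable `[-3, 1] (EFin \o Ht).
    apply: continuous_compact_integrable; first exact: segment_compact.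
    exact: continuous_subspaceT.
  apply: subr0_eq; rewrite /Phi (Rintegral_itvB i31) ?bnd_simp//.
  rewrite Rintegral_itv_obnd_cbnd; last first.
    apply: integrableS i31 => // x /=; rewrite !in_itv/= => /andP[x0 ->].
    by rewrite andbT; lra.
  by rewrite -[RHS]IH; apply: eq_int01 => u /HtE.
have PhiS (x : R) : -2 < x -> x <= 0 -> Phi (x + 1) = Phi x.
  move=> x2 x0; pose D y := Phi (y + 1) - Phi y.
  have dD (y : R) : -2 <= y -> is_derive y 1 D 0.
    move=> y2; have h1 : is_derive (y + 1) 1 Phi (Ht (y + 1)) by apply: dPhi; lra.
    have h2 : is_derive y 1 Phi (Ht y) by apply: dPhi; lra.
    rewrite -[X in is_derive _ _ _ X](subrr (Ht y)).
    apply: is_deriveB; rewrite -(Htp y) -[X in is_derive _ _ _ X]mulr1.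
    apply: (@is_derive1_comp _ Phi (fun y => y + 1) y _ 1 h1).
    by apply: is_derive_eq; rewrite addr0.
  have cD : {within `[x, 0], continuous D}.
    apply: derivable_within_continuous => y; rewrite in_itv/= => /andP[xy _].
    by apply: ex_derive; apply: dD; lra.
  have [|c _] := MVT_segment x0 (df := fun=> 0) _ cD.
    by move=> y; rewrite in_itv/= => /andP[xy _]; apply: dD; lra.
  rewrite /D; have : Phi (0 + 1) = Phi 0 by rewrite add0r.
  lra.
pose phi x := Phi (x - (Num.floor x)%:~R).
have dphi (x : R) : is_derive x 1 phi (Ht x).
  set n := Num.floor x.
  have [x0 x1] : n%:~R - 1 < x /\ x < n%:~R + 1 by exact: nbhs_singleton (near_floor x).
  have phin : \near x, Phi (x - n%:~R) = phi x.
    near=> y.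
    have [y0 y1] : n%:~R - 1 < y /\ y < n%:~R + 1 by near: y; exact: near_floor.
    rewrite /phi; case: (floor_cases y0 y1) => -[ny ->] //.
    have -> : y - (n - 1)%:~R = y - n%:~R + 1 by rewrite intrB; ring.
    by rewrite PhiS//; lra.
  apply: near_eq_is_derive phin _.
  have HtnE : Ht (x - n%:~R) = Ht x.
    rewrite /Ht floorDrz ?rpredN ?intr_int// floorN ?intr_int// intrKfloor.
    by rewrite intrD intrN; congr H; ring.
  rewrite -HtnE -[Ht _]mulr1.
  apply: (@is_derive1_comp _ Phi (fun y => y - n%:~R)).
    by apply: dPhi; lra.
  by apply: is_derive_eq; rewrite subr0.
have phi' : derive1 phi = Ht.
  by apply/funext => x; rewrite derive1E; apply: derive_val.
exists phi; last by move=> u u01; rewrite phi' HtE.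
split; [exact: frac_periodic|by move=> x; exact: ex_derive|by rewrite phi'].
Unshelve. all: by end_near. Qed.

Lemma test_function_primitive {R : realType} (phi : R -> R) :
  test_function phi -> primitive_of phi (derive1 phi).
Proof.
move=> [_ dphi cphi].
split; first exact/integrable01_continuous/continuous_subspaceT.
move=> u; rewrite in_itv/= le_eqVlt => /andP[/predU1P[<-|u0] u1].
  by rewrite set_itv1 Rintegral_set1 addr0.
have cp x : {for x, continuous phi}.
  by apply: differentiable_continuous; rewrite -derivable1_diffP; exact: dphi.
have dp : derivable_oo_LRcontinuous phi 0 u.
  split => [x _||]; first exact: dphi.
  + exact: cvg_at_right_filter (cp 0).
  + exact: cvg_at_left_filter (cp u).
have cd : {within `[0, u], continuous (derive1 phi)} by exact: continuous_subspaceT.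
by rewrite /Rintegral (continuous_FTC2 u0 cd dp)//=; ring.
Qed.

Lemma ae01_witness_itv {R : realType} (P : R -> Prop) (a b : R) :
  0 <= a -> a < b -> b <= 1 -> ae01 P -> exists2 u, u \in `[a, b] & P u.
Proof.
move=> a0 ab b1 [N [mN N0 sN]]; apply: contrapT => h.
have : (mu (`[a, b]%classic : set (measurableTypeR R)) <= mu N)%E.
  apply: le_measure; rewrite ?inE// => u /= uab; apply: sN => /= Pu.
  apply: h; exists u => //; apply: Pu; exact: (subset_itv_cc a0 b1 uab).
rewrite N0 lebesgue_measure_itv/= lte_fin ab EFinN -EFinB lee_fin; lra.
Qed.

Lemma continuous01_ae_eq0 {R : realType} (f : R -> R) :
  {within `[0, 1], continuous f} -> ae01 (fun u => f u = 0) ->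
  forall u : R, u \in `[0, 1] -> f u = 0.
Proof.
move=> cf f0 u u01; apply/eqP; apply: contraT => fu.
have fu0 : 0 < `|f u| by rewrite normr_gt0.
have := cf u; move/cvgrPdist_lt => /(_ _ fu0).
rewrite {1}/nbhs/= /nbhs_subspace mem_set//.
move=> [/= d d0 fd].
move: (u01); rewrite in_itv/= => /andP[u0 u1].
have [v vab fv] : exists2 v,
    v \in `[Num.max 0 (u - d / 2), Num.min 1 (u + d / 2)] & f v = 0.
  apply: ae01_witness_itv => //.
  - by rewrite le_max lexx.
  - by rewrite lt_min !gt_max; apply/andP; split; apply/andP; split; lra.
  - by rewrite ge_min lexx.
move: vab; rewrite in_itv/= ge_max le_min => /andP[/andP[v0 v1] /andP[v2 v3]].
have /fd : ball_ [eta Num.norm] u d v.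
  by rewrite /ball_/= ltr_norml; apply/andP; split; lra.
rewrite /= in_itv/= v0 v2 => /(_ isT) fuv.
have : `|f u - f v| < `|f u| by exact: fuv.
by rewrite fv subr0 ltxx.
Qed.

(** The du Bois-Reymond lemma.  Let [G] be the primitive of [g], and [H] the
    function [f - G] minus its mean.  Since [H] is continuous and of mean zero
    on the circle, its antiderivative is itself a test function.  Testing the
    weak derivative with it, and integrating by parts against [G], shows that
    [f - G] is orthogonal to [H], hence that the integral of [H ^+ 2]
    vanishes. *)
Lemma weak_deriv_primitive {R : realType} (f g : R -> R) :
  {within `[0, 1], continuous f} -> f 0 = f 1 -> is_weak_deriv f g ->
  primitive_of f g.
Proof.
move=> cf f01 [fi gi fg].
pose G u := 0 + itg 0 u g.
have Gg : primitive_of G g := primitive_itg 0 gi.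
have cG := primitive_continuous Gg.
have G0 : G 0 = 0 by rewrite /G set_itv1 Rintegral_set1 addr0.
(* The constant test function shows that [g] has mean zero. *)
have G1 : G 1 = 0.
  have t1 : test_function (cst 1 : R -> R).
    split; [by []|by move=> x; apply: ex_derive; exact: is_derive_cst|].
    have -> : derive1 (cst 1 : R -> R) = cst 0.
      by apply/funext => x; rewrite derive1_cst.
    by move=> x; exact: cvg_cst.
  have := fg _ t1.
  rewrite (eq_int01 (g := fun=> 0)); last by move=> u _; rewrite derive1_cst mulr0.
  rewrite int01_cst => /esym/eqP; rewrite oppr_eq0 => /eqP.
  by rewrite /G add0r; under eq_int01 do rewrite mulr1.
pose c := int01 (fun u => f u - G u).
pose H u := f u - G u - c.
have cfG : {within `[0, 1], continuous (fun u => f u - G u)}.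
  by move=> u; apply: cvgB; [exact: cf|exact: cG].
have cH : {within `[0, 1], continuous H}.
  by move=> u; apply: cvgB; [exact: cfG|exact: cvg_cst].
have fGi := integrable01_continuous cfG.
have IH : int01 H = 0.
  rewrite /H int01B//; last exact: integrable01_cst.
  by rewrite int01_cst subrr.
have H01 : H 0 = H 1 by rewrite /H f01 G0 G1.
have [phi tphi phiH] := test_function_antiderivative cH H01 IH.
have Pphi := test_function_primitive tphi.
have cphi := primitive_continuous Pphi.
have e1 : int01 (fun u => f u * H u) = - int01 (fun u => phi u * g u).
  rewrite -(eq_int01 (f := fun u => f u * derive1 phi u)); last by move=> u /phiH ->.
  by rewrite fg//; congr (- _); apply: eq_int01 => u _; rewrite mulrC.
have e2 : int01 (fun u => phi u * g u) = - int01 (fun u => H u * G u).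
  rewrite (primitive_by_parts Pphi Gg) ?G0 ?G1 ?mulr0//.
  by congr (- _); apply: eq_int01 => u /phiH ->.
have Hi := integrable01_continuous cH.
have e3 : int01 (fun u => H u * H u) = 0.
  have -> : int01 (fun u => H u * H u) =
      int01 (fun u => f u * H u - H u * G u - c * H u).
    by apply: eq_int01 => u _; rewrite {1}/H; ring.
  rewrite int01B; last exact: integrable01Zl.
    rewrite int01Zl// IH mulr0 subr0 int01B ?e1 ?e2 ?opprK ?subrr//.
      exact: integrable01_continuousM.
    exact/integrable01_continuousM/integrable01_continuous.
  apply: integrable01B; first exact: integrable01_continuousM.
  exact/integrable01_continuousM/integrable01_continuous.
have H0 (u : R) : u \in `[0, 1] -> H u = 0.
  apply: continuous01_ae_eq0 => //.
  have := int01_ge0_eq0 (integrable01_continuousM cH Hi) _ e3.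
  move=> /(_ (fun u _ => sqr_ge0 (H u))).
  by apply: ae01S => v _ /eqP; rewrite mulf_eq0 orbb => /eqP.
have fE (u : R) : u \in `[0, 1] -> f u = G u + c.
  by move=> /H0; rewrite /H; lra.
split=> // u u01; rewrite (fE _ u01) (fE 0) ?G0 ?in_itv/= ?lexx ?ler01//.
by rewrite /G; ring.
Qed.

Lemma primitive_weak_deriv {R : realType} (f g : R -> R) :
  primitive_of f g -> f 0 = f 1 -> is_weak_deriv f g.
Proof.
move=> fg f01; split; [|exact: fg.1|].
  exact/integrable01_continuous/(primitive_continuous fg).
move=> phi tphi; apply: primitive_by_parts => //.
  exact: test_function_primitive.
by have [/(_ 0) + _ _] := tphi; rewrite add0r f01 => ->.
Qed.

(** The primitive of [f - g] vanishes, and Lebesgue's differentiation theorem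
    recovers the integrand. *)
Lemma primitive_unique {R : realType} (F f g : R -> R) :
  primitive_of F f -> primitive_of F g -> ae01 (fun u => f u = g u).
Proof.
move=> [fi Ff] [gi Fg].
pose d u := f u - g u.
have di : integrable01 d by exact: integrable01B.
have d0 (u : R) : u \in `[0, 1] -> itg 0 u d = 0.
  move=> u01; move: (u01); rewrite in_itv/= => /andP[u0 u1].
  rewrite RintegralB//; try exact: integrable_itv.
  by have := Ff _ u01; rewrite (Fg _ u01); lra.
pose D := d \_ `[0, 1].
have Di : mu.-integrable setT (EFin \o D).
  by have /integrable_mkcond := di; rewrite restrict_EFin; apply.
have Dl : locally_integrable setT D by exact: integrable_locally.
have Dy (y : R) : mu.-integrable [set` Interval (BLeft 0) (BRight y)] (EFin \o D).
  exact: integrableS Di.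
have := FTC1 Dy Dl.
(* The primitive is known to vanish around interior points only, so the two
   endpoints join the exceptional set. *)
move=> /= [N [mN N0 sN]]; exists (N `|` [set 0] `|` [set 1]); split.
- by apply: measurableU => //; exact: measurableU.
- rewrite null_set_setU//; [exact: measurableU| |exact: lebesgue_measure_set1].
  by rewrite null_set_setU//; exact: lebesgue_measure_set1.
move=> u /= nfg; apply: contrapT => /not_orP[/not_orP[uN u0] u1]; apply: nfg => u01.
have [{}u0 {}u1] : 0 < u /\ u < 1.
  move: u01; rewrite in_itv/= !le_eqVlt => /andP[/predU1P[/esym//|?] /predU1P[//|?]].
  by [].
pose ID x := itg 0 x D.
have [_] : derivable ID u 1 /\ derive1 ID u = D u.
  by apply: contrapT => h; apply: uN; apply: sN => /= /(_ u0)/h.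
rewrite /D patchE mem_set//= derive1E.
have /near_eq_derive -> : \near u, ID u = cst 0 u.
  near=> x.
  have x01 : x \in `[0, 1].
    rewrite in_itv/=; apply/andP; split; apply/ltW; near: x.
      exact: lt_nbhsr.
    exact: lt_nbhsl.
  rewrite -[RHS](d0 _ x01); apply: eq_Rintegral => t; rewrite inE/= => tx.
  rewrite /D patchE mem_set//=; apply: subset_itv_cc tx => //.
  by move: x01; rewrite in_itv/= => /andP[].
by rewrite derive_cst => /esym/subr0_eq.
Unshelve. all: by end_near. Qed.

Lemma W11_primitive {R : realType} (f : R -> R) :
  W11 f -> primitive_of f (weak_deriv f).
Proof.
by move=> [cf f01 fg]; apply: weak_deriv_primitive => //; exact: (xgetPex (cst 0) fg).
Qed.

Lemma primitive_W11 {R : realType} (f g : R -> R) :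
  primitive_of f g -> f 0 = f 1 -> W11 f.
Proof.
move=> fg f01; split => //; first exact: primitive_continuous fg.
by exists g; exact: primitive_weak_deriv.
Qed.

Lemma weak_deriv_ae {R : realType} (f g : R -> R) :
  primitive_of f g -> f 0 = f 1 -> ae01 (fun u => weak_deriv f u = g u).
Proof.
move=> fg f01; apply: (primitive_unique _ fg).
exact: W11_primitive (primitive_W11 fg f01).
Qed.

(** * The Green function of the circle *)

(** The profile is symmetric about 1/2, so its 1-periodic extension agrees on
    [[-1, 1]] with its even extension. *)
Lemma kernelG_norm_le1 {R : realType} (lambda x : R) :
  `|x| <= 1 -> kernelG lambda x = kernelG0 lambda x.
Proof.
have coshN (y : R) : cosh (- y) = cosh y by rewrite /cosh opprK addrC.
rewrite ler_norml => /andP[x0 x1]; rewrite /kernelG.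
have [xp|xn] := leP 0 x; last first.
  rewrite (@floor_def _ _ (-1)); last by rewrite addNr xn andbT intrN.
  rewrite intrN opprK /kernelG0 (ltr0_norm xn) ger0_norm; last lra.
  have -> : (x + 1 - 1 / 2) / lambda = - ((- x - 1 / 2) / lambda).
    by rewrite -[RHS]mulNr; congr (_ * _); field.
  by rewrite coshN.
move: x1; rewrite le_eqVlt => /predU1P[->|x1].
  rewrite floor1 subrr /kernelG0 normr0 normr1.
  have -> : (1 - 1 / 2) / lambda = - ((0 - 1 / 2) / lambda).
    by rewrite -[RHS]mulNr; congr (_ * _); field.
  by rewrite coshN.
by rewrite (@floor_def _ _ 0) ?subr0// xp.
Qed.

(** The addition formula separates the two variables of the kernel, which turns
    the convolution into products of primitives. *)
Lemma kernelG0_expR {R : realType} (lambda x y : R) (r := lambda^-1)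
    (c := r / (2 * (expR (- (r / 2)) - expR (r / 2)))) : 0 < lambda -> y <= x ->
  kernelG0 lambda (x - y) = kernelG0 lambda (y - x) /\
  kernelG0 lambda (x - y) =
    c * (expR (- (r / 2)) * (expR (r * x) * expR (- r * y)) +
         expR (r / 2) * (expR (- r * x) * expR (r * y))).
Proof.
move=> l0 yx; split; first by rewrite /kernelG0 distrC.
have l1 : lambda != 0 by rewrite gt_eqF.
rewrite /kernelG0 ger0_norm ?subr_ge0// /cosh /sinh -!expRD.
have -> : (x - y - 1 / 2) / lambda = - (r / 2) + (r * x + - r * y).
  by rewrite /r; field.
have -> : - (- (r / 2) + (r * x + - r * y)) = r / 2 + (- r * x + r * y) by ring.
have -> : 1 / (2 * lambda) = r / 2 by rewrite /r; field.
have : expR (- (r / 2)) - expR (r / 2) != 0.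
  rewrite lt_eqF// subr_lt0 ltr_expR.
  have : 0 < r / 2 by rewrite divr_gt0// invr_gt0.
  lra.
rewrite /c /r; set q := expR (lambda^-1 / 2); set qi := expR _ => q0.
by field; rewrite l1/=; apply/andP; split => //; rewrite -[_ - _]opprB oppr_eq0.
Qed.

Section green.
Context {R : realType}.
Variables (lambda : R) (f w rho : R -> R).

(* The exponentials [E] and [Ei] come from the addition formula, [P] and [N] are
   the partial integrals of [f] against them. *)
Let k u := int01 (fun v => f v * kernelG lambda (rho v - rho u) * w v).
Let r := lambda^-1.
Let q := expR (r / 2).
Let qi := expR (- (r / 2)).
Let c := r / (2 * (qi - q)).
Let E u := expR (r * rho u).
Let Ei u := expR (- r * rho u).
Let P u := itg 0 u (fun v => E v * (f v * w v)).
Let N u := itg 0 u (fun v => Ei v * (f v * w v)).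

Hypothesis lambda0 : 0 < lambda.
Hypothesis rho_w : primitive_of rho w.
Hypothesis rho0 : rho 0 = 0.
Hypothesis rho1 : rho 1 = 1.
Hypothesis w0 : forall u : R, u \in `[0, 1] -> 0 <= w u.
Hypothesis cf : {within `[0, 1], continuous f}.

Let fwi : integrable01 (fun v => f v * w v).
Proof. exact: integrable01_continuousM rho_w.1. Qed.

Let EE : primitive_of E (fun u => E u * (r * w u)).
Proof. exact/primitive_expR/primitiveZ. Qed.

Let EEi : primitive_of Ei (fun u => Ei u * (- r * w u)).
Proof. exact/primitive_expR/primitiveZ. Qed.

Let Pi : integrable01 (fun v => E v * (f v * w v)).
Proof. exact: integrable01_continuousM (primitive_continuous EE) fwi. Qed.

Let Ni : integrable01 (fun v => Ei v * (f v * w v)).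
Proof. exact: integrable01_continuousM (primitive_continuous EEi) fwi. Qed.

Let P0 : P 0 = 0.
Proof. by rewrite /P set_itv1 Rintegral_set1. Qed.

Let N0 : N 0 = 0.
Proof. by rewrite /N set_itv1 Rintegral_set1. Qed.

Let PP : primitive_of P (fun v => E v * (f v * w v)).
Proof. by split=> // u _; rewrite P0 add0r. Qed.

Let PN : primitive_of N (fun v => Ei v * (f v * w v)).
Proof. by split=> // u _; rewrite N0 add0r. Qed.

Let rho_mono (a b : R) : 0 <= a -> a <= b -> b <= 1 -> rho a <= rho b.
Proof.
move=> a0 ab b1; rewrite -subr_ge0 (primitive_incr rho_w)//.
apply: Rintegral_ge0 => x /=; rewrite in_itv/= => /andP[ax xb].
by apply: w0; rewrite in_itv/= (le_trans a0 ax) (le_trans xb).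
Qed.

Let rho_dist (a b : R) : a \in `[0, 1] -> b \in `[0, 1] -> `|rho a - rho b| <= 1.
Proof.
have h (x : R) : x \in `[0, 1] -> 0 <= rho x <= 1.
  rewrite in_itv/= => /andP[x0 x1].
  by rewrite -{1}rho0 -rho1 !rho_mono.
move=> /h/andP[? ?] /h/andP[? ?]; rewrite ler_norml; apply/andP; split; lra.
Qed.

Let kE (u : R) : u \in `[0, 1] ->
  k u = c * (qi * (E u * N u) + q * (Ei u * P u) +
             qi * (Ei u * (P 1 - P u)) + q * (E u * (N 1 - N u))).
Proof.
move=> u01; move: (u01); rewrite in_itv/= => /andP[u0 u1].
pose h v := f v * kernelG lambda (rho v - rho u) * w v.
have I0 A : integrable01 A -> mu.-integrable `[0, u] (EFin \o A) by exact: integrable_itv.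
have I1 A : integrable01 A -> mu.-integrable `[u, 1] (EFin \o A) by exact: integrable_itv.
pose x1 := c * qi * E u; pose x2 := c * q * Ei u.
pose y1 := c * qi * Ei u; pose y2 := c * q * E u.
pose h0 v := x1 * (Ei v * (f v * w v)) + x2 * (E v * (f v * w v)).
pose h1 v := y1 * (E v * (f v * w v)) + y2 * (Ei v * (f v * w v)).
have hh0 (v : R) : v \in `[0, u] -> h v = h0 v.
  rewrite in_itv/= => /andP[v0 vu].
  rewrite /h kernelG_norm_le1; last by rewrite rho_dist// in_itv/= v0 (le_trans vu).
  have [<- ->] := kernelG0_expR lambda0 (rho_mono v0 vu u1).
  by rewrite /h0 /x1 /x2 /E /Ei /c /q /qi /r; ring.
have hh1 (v : R) : v \in `[u, 1] -> h v = h1 v.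
  rewrite in_itv/= => /andP[uv v1].
  rewrite /h kernelG_norm_le1; last by rewrite rho_dist// in_itv/= v1 (le_trans u0).
  have [_ ->] := kernelG0_expR lambda0 (rho_mono u0 uv v1).
  by rewrite /h1 /y1 /y2 /E /Ei /c /q /qi /r; ring.
have i0 : itg 0 u h = x1 * N u + x2 * P u.
  have -> : itg 0 u h = itg 0 u h0.
    by apply: eq_Rintegral => v; rewrite inE => /hh0.
  by rewrite RintegralD ?RintegralZl//; try exact: I0; exact/I0/integrable01Zl.
have i1 : itg u 1 h = y1 * (P 1 - P u) + y2 * (N 1 - N u).
  have -> : itg u 1 h = itg u 1 h1.
    by apply: eq_Rintegral => v; rewrite inE => /hh1.
  rewrite (primitive_incr PP u0 u1)// (primitive_incr PN u0 u1)//.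
  by rewrite RintegralD ?RintegralZl//; try exact: I1; exact/I1/integrable01Zl.
have hi : integrable01 h.
  pose hc v := f v * kernelG0 lambda (rho v - rho u).
  have chc : {within `[0, 1], continuous hc}.
    move=> x; apply: cvgM; first exact: cf.
    apply: cvgN; apply: cvgMl.
    rewrite /cosh; apply: cvgMl; apply: cvgD.
      apply: continuous_comp; last exact: continuous_expR.
      apply: cvgMl; apply: cvgB; last exact: cvg_cst.
      apply: cvg_norm; apply: cvgB; last exact: cvg_cst.
      exact: primitive_continuous rho_w _.
    apply: continuous_comp; last exact: continuous_expR.
    apply: cvgN; apply: cvgMl; apply: cvgB; last exact: cvg_cst.
    apply: cvg_norm; apply: cvgB; last exact: cvg_cst.
    exact: primitive_continuous rho_w _.
  apply: eq_integrable (integrable01_continuousM chc rho_w.1) => // v.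
  by rewrite inE => v01 /=; rewrite /h kernelG_norm_le1 ?rho_dist.
have -> : k u = itg 0 u h + itg u 1 h by rewrite -itg_split.
rewrite i0 i1 /x1 /x2 /y1 /y2; ring.
Qed.

Let m u := c * r * (qi * (E u * N u) - q * (Ei u * P u)
                    - qi * (Ei u * (P 1 - P u)) + q * (E u * (N 1 - N u))).

(** In the arc length parameter [rho], the convolution [k] solves
    [lambda ^ 2 k'' = k + f] on the circle: [kernelG] is minus the periodic
    Green function of [1 - lambda ^ 2 d^2/ds^2], and the jump of its derivative
    at 0 produces the term [f].  The equation is stated as a first order
    system, with [m] the derivative of [k] with respect to [rho], as [rho] is
    only absolutely continuous. *)
Lemma green_solution : exists m : R -> R,
  [/\ m 0 = m 1, k 0 = k 1, primitive_of k (fun u => m u * w u) &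
      primitive_of m (fun u => lambda ^- 2 * (k u + f u) * w u)].
Proof.
have l1 : lambda != 0 by rewrite gt_eqF.
have E0 u : E u != 0 by rewrite gt_eqF// expR_gt0.
have EiE u : Ei u = (E u)^-1 by rewrite /Ei mulNr expRN.
have qiE : qi = q^-1 by rewrite /qi expRN.
have q0 : q != 0 by rewrite gt_eqF// expR_gt0.
have Eat0 : E 0 = 1 by rewrite /E rho0 mulr0 expR0.
have Eat1 : E 1 = q * q by rewrite /E rho1 mulr1 -expRD; congr expR; field.
have z0 : (0 : R) \in `[0, 1] by rewrite in_itv/= lexx ler01.
have z1 : (1 : R) \in `[0, 1] by rewrite in_itv/= lexx ler01.
have qq : qi - q != 0.
  rewrite lt_eqF// subr_lt0 ltr_expR.
  have : 0 < r / 2 by rewrite divr_gt0// invr_gt0.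
  lra.
have P1P : primitive_of (fun u => P 1 - P u) (fun v => - 1 * (E v * (f v * w v))).
  apply: primitive_ext (primitiveD (primitive_cst (P 1)) (primitiveZ (-1) PP)) => u _ /=.
    by rewrite mulN1r.
  by rewrite add0r.
have N1N : primitive_of (fun u => N 1 - N u) (fun v => - 1 * (Ei v * (f v * w v))).
  apply: primitive_ext (primitiveD (primitive_cst (N 1)) (primitiveZ (-1) PN)) => u _ /=.
    by rewrite mulN1r.
  by rewrite add0r.
(* In the derivative of [k] the terms from the derivatives of [P] and [N]
   cancel, as the kernel is continuous; in that of [m] they add up to [f]. *)
have T1 := primitiveZ qi (primitiveM EE PN).
have T2 := primitiveM EEi PP.
have T3 := primitiveM EEi P1P.
have T4 := primitiveZ q (primitiveM EE N1N).
exists m; split.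
- by rewrite /m !EiE Eat0 Eat1 P0 N0 qiE; field.
- by rewrite !kE// !EiE Eat0 Eat1 P0 N0 qiE; field.
- apply: primitive_ext (primitiveZ c (primitiveD (primitiveD (primitiveD T1
    (primitiveZ q T2)) (primitiveZ qi T3)) T4)) => u u01; first by rewrite kE.
  by rewrite /m !EiE; field.
- apply: primitive_ext (primitiveZ (c * r) (primitiveD (primitiveD (primitiveD T1
    (primitiveZ (- q) T2)) (primitiveZ (- qi) T3)) T4)) => u u01.
    by rewrite /m; ring.
  rewrite kE// !EiE /c /r; field.
  by rewrite l1 E0 qq.
Qed.

End green.

(** * Differentiation of an integral of norms *)

Lemma int01_dominated_cvg {R : realType} (h : nat -> R -> R) (f g : R -> R) :
  (forall n, meas01 (h n)) -> meas01 f -> integrable01 g ->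
  ae01 (fun u => h n u @[n --> \oo] --> f u) ->
  (forall n (u : R), u \in `[0, 1] -> `|h n u| <= g u) ->
  int01 (h n) @[n --> \oo] --> int01 f.
Proof.
move=> mh mf gi hf hg.
have [] := @dominated_convergence _ _ _ mu `[0%R, 1%R]%classic (measurable_itv _)
  (fun n => EFin \o h n) (EFin \o f) (EFin \o g).
- by move=> n; exact/measurable_EFinP.
- exact/measurable_EFinP.
- by apply: ae01S hf => u _ hu; apply: cvg_EFin => //; exact: nearW.
- exact: gi.
- by apply: aeW => u n u01 /=; rewrite lee_fin hg.
move=> fi _; have fin : (\int[mu]_(x in `[0%R, 1%R]) (EFin \o f) x)%E \is a fin_num.
  exact: integrable_fin_num.
by rewrite -(fineK fin) => /fine_cvg.
Qed.

Lemma dotp2 {R : realType} (x y : 'rV[R]_2) :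
  dotp x y = x 0 ord0 * y 0 ord0 + x 0 ord_max * y 0 ord_max.
Proof.
rewrite /dotp big_ord_recr/= big_ord1.
by congr (x 0 _ * y 0 _ + _); apply/val_inj.
Qed.

Lemma dotp_ge0 {R : realType} (x : 'rV[R]_2) : 0 <= dotp x x.
Proof. by apply: sumr_ge0 => i _; exact: sqr_ge0. Qed.

Lemma enorm_ge0 {R : realType} (x : 'rV[R]_2) : 0 <= enorm x.
Proof. exact: sqrtr_ge0. Qed.

Lemma sqr_enorm {R : realType} (x : 'rV[R]_2) : enorm x ^+ 2 = dotp x x.
Proof. by rewrite sqr_sqrtr// dotp_ge0. Qed.

Lemma coord_le_enorm {R : realType} (x : 'rV[R]_2) (i : 'I_2) :
  `|x 0 i| <= enorm x.
Proof.
rewrite -sqrtr_sqr ler_wsqrtr// /dotp (bigD1 i)//= expr2 lerDl.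
by apply: sumr_ge0 => j _; exact: sqr_ge0.
Qed.

Lemma enorm_gt0 {R : realType} (x : 'rV[R]_2) : (0 < enorm x) = (0 < dotp x x).
Proof. by rewrite sqrtr_gt0. Qed.

Lemma dotp_le_enorm {R : realType} (x y : 'rV[R]_2) :
  `|dotp x y| <= enorm x * enorm y.
Proof.
rewrite -sqrtrM ?dotp_ge0// -sqrtr_sqr ler_wsqrtr// !dotp2 -subr_ge0.
set a := x 0 _; set b := x 0 _; set c := y 0 _; set d := y 0 _.
by rewrite (_ : _ - _ = (a * d - b * c) ^+ 2) ?sqr_ge0//; ring.
Qed.

Lemma dotpDD {R : realType} (x y : 'rV[R]_2) :
  dotp (x + y) (x + y) = dotp x x + 2 * dotp x y + dotp y y.
Proof. by rewrite !dotp2 !mxE; ring. Qed.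

Lemma enormD_le {R : realType} (x y : 'rV[R]_2) :
  enorm (x + y) <= enorm x + enorm y.
Proof.
rewrite -(@ler_pXn2r _ 2)// ?nnegrE ?addr_ge0 ?enorm_ge0//.
have := le_trans (ler_norm _) (dotp_le_enorm x y).
rewrite sqrrD !sqr_enorm dotpDD mulr2n; lra.
Qed.

Lemma enormZ {R : realType} (t : R) (x : 'rV[R]_2) :
  enorm (t *: x) = `|t| * enorm x.
Proof.
rewrite /enorm -sqrtr_sqr -sqrtrM ?sqr_ge0//; congr Num.sqrt.
by rewrite !dotp2 !mxE; ring.
Qed.

Lemma enorm_lipschitz {R : realType} (x y : 'rV[R]_2) :
  `|enorm (x + y) - enorm x| <= enorm y.
Proof.
rewrite ler_norml; apply/andP; split; last first.
  by rewrite lerBlDl enormD_le.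
have := enormD_le (x + y) (- 1 *: y).
rewrite enormZ normrN1 mul1r scaleN1r addrK; lra.
Qed.

Lemma enorm_is_derive {R : realType} (p q : 'rV[R]_2) : 0 < enorm p ->
  is_derive (0 : R) (1 : R) (fun t : R => enorm (p + t *: q)) (dotp p q / enorm p).
Proof.
move=> p0; have dp0 : 0 < dotp p p by rewrite -enorm_gt0.
pose Q (t : R) := dotp p p + 2 * dotp p q * t + dotp q q * (t * t).
have QE t : dotp (p + t *: q) (p + t *: q) = Q t.
  by rewrite /Q !dotp2 !mxE; ring.
rewrite (_ : (fun t : R => _) = Num.sqrt \o Q); last first.
  by apply/funext => t; rewrite /enorm QE.
have dQ : is_derive (0 : R) (1 : R) Q (2 * dotp p q).
  by apply: is_derive_eq; rewrite /GRing.scale/=; ring.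
have Q0 : Q 0 = dotp p p by rewrite /Q; ring.
have dS := is_derive1_sqrt dp0; rewrite -Q0 in dS.
have := is_derive1_comp dS dQ; rewrite Q0 => d.
apply: is_derive_eq d _; rewrite -/(enorm p).
by field; rewrite gt_eqF.
Qed.

Lemma enorm_meas {R : realType} (p : R -> 'rV[R]_2) :
  (forall i, meas01 (fun u => p u 0 i)) -> meas01 (fun u => enorm (p u)).
Proof.
move=> mp; have ms : measurable_fun [set: R] (@Num.sqrt R).
  by apply: continuous_measurable_fun; exact: sqrt_continuous.
apply: (measurableT_comp ms).
by apply: measurable_sum => i; exact: measurable_funM.
Qed.

(** On nonnegative numbers the inverse, which is 0 at 0, is the power of
    exponent -1, a measurable function. *)
Lemma enormV_meas {R : realType} (p : R -> 'rV[R]_2) :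
  (forall i, meas01 (fun u => p u 0 i)) -> meas01 (fun u => (enorm (p u))^-1).
Proof.
move=> mp.
have -> : (fun u => (enorm (p u))^-1) = (fun u => enorm (p u) `^ (- 1)).
  by apply/funext => u; rewrite powRN powRr1 ?enorm_ge0.
exact: (measurableT_comp (measurable_powR (- 1)) (enorm_meas mp)).
Qed.

Lemma enorm_integrable {R : realType} (p : R -> 'rV[R]_2) :
  (forall i, integrable01 (fun u => p u 0 i)) -> integrable01 (fun u => enorm (p u)).
Proof.
move=> ip.
apply: (@integrable01_le _ _ (fun u => \sum_(i < 2) `|p u 0 i|)).
- by apply: enorm_meas => i; exact: integrable01_meas.
- move=> u _; rewrite ger0_norm ?enorm_ge0// -(@ler_pXn2r _ 2)//; last 2 first.
  + by rewrite nnegrE enorm_ge0.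
  + by rewrite nnegrE sumr_ge0.
  rewrite sqr_enorm dotp2 big_ord_recr/= big_ord1 sqrrD !real_normK ?num_real//.
  rewrite -!expr2 (_ : widen_ord _ _ = ord0); last exact/val_inj.
  have := mulr_ge0 (normr_ge0 (p u 0 ord0)) (normr_ge0 (p u 0 ord_max)).
  rewrite mulr2n; lra.
- by apply: (int01_sum _).1 => i; exact: integrable01_norm.
Qed.

(** Dominated convergence: the difference quotients converge wherever [p] does
    not vanish, and the Lipschitz bound for the norm dominates them by
    [enorm (q u)]. *)
Lemma int01_enorm_is_derive {R : realType} (p q : R -> 'rV[R]_2) :
  (forall i, integrable01 (fun u => p u 0 i)) ->
  (forall i, integrable01 (fun u => q u 0 i)) ->
  ae01 (fun u => 0 < enorm (p u)) ->
  is_derive (0 : R) (1 : R) (fun t : R => int01 (fun u => enorm (p u + t *: q u)))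
    (int01 (fun u => dotp (p u) (q u) / enorm (p u))).
Proof.
move=> ip iq p0.
pose F (t : R) := int01 (fun u => enorm (p u + t *: q u)).
set l := int01 _.
have int_pq (t : R) : integrable01 (fun u => enorm (p u + t *: q u)).
  apply: enorm_integrable => i; under eq_fun do rewrite !mxE.
  exact/integrable01D/integrable01Zl.
have mdot : meas01 (fun u => dotp (p u) (q u) / enorm (p u)).
  apply: measurable_funM.
    by apply: measurable_sum => i; apply: measurable_funM; exact: integrable01_meas.
  by apply: enormV_meas => i; exact: integrable01_meas.
have cvgF : h^-1 *: (F (h *: 1 + 0) - F 0) @[h --> 0^'] --> l.
  apply/cvgr_dnbhsP => t [t0 tcvg].
  pose g n u := (t n)^-1 * (enorm (p u + t n *: q u) - enorm (p u)).
  have gi n : integrable01 (g n).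
    by apply/integrable01Zl/integrable01B => //; exact: enorm_integrable.
  have -> : (fun n => (t n)^-1 *: (F (t n *: 1 + 0) - F 0)) = (fun n => int01 (g n)).
    apply/funext => n; rewrite /F /g addr0 (_ : t n *: 1 = t n); last exact: mulr1.
    rewrite int01Zl ?int01B//.
    - congr (_ * (_ - _)); apply: eq_int01 => u _.
      by rewrite scale0r addr0.
    - exact: enorm_integrable.
    - by apply/integrable01B => //; exact: enorm_integrable.
  apply: (@int01_dominated_cvg _ g _ (fun u => enorm (q u))) => //.
  - by move=> n; exact: integrable01_meas.
  - exact: enorm_integrable.
  - apply: ae01S p0 => u _ pu.
    have [dE EE] := enorm_is_derive (q u) pu.
    have : h^-1 *: (enorm (p u + (h *: 1 + 0) *: q u) - enorm (p u + 0 *: q u))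
        @[h --> 0^'] --> dotp (p u) (q u) / enorm (p u).
      by rewrite -EE; exact: dE.
    move/cvgr_dnbhsP => /(_ t (conj t0 tcvg)).
    have -> // : (fun n => g n u) = (fun n => (t n)^-1 *:
        (enorm (p u + (t n *: 1 + 0) *: q u) - enorm (p u + 0 *: q u))).
    apply/funext => n; rewrite /g addr0 scale0r addr0.
    by rewrite (_ : t n *: 1 = t n)//; exact: mulr1.
  - move=> n u _; rewrite /g normrM normfV ler_pdivrMl ?normr_gt0//.
    by rewrite -enormZ enorm_lipschitz.
apply: DeriveDef; first by apply/cvg_ex; exists l.
exact: cvg_lim.
Qed.

(** * The gradient of the length *)

Lemma curveW11_cderiv_integrable {R : realType} (gamma : R -> 'rV[R]_2) (i : 'I_2) :
  curveW11 gamma -> integrable01 (fun u => cderiv gamma u 0 i).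
Proof. by move=> /(_ i)/W11_primitive[wi _]; under eq_fun do rewrite mxE. Qed.

Lemma coord_comb {R : realType} (t : R) (p q : R -> 'rV[R]_2) (i : 'I_2) :
  (fun u => (p u + t *: q u) 0 i) = (fun u => p u 0 i + t * q u 0 i).
Proof. by apply/funext => u; rewrite !mxE. Qed.

Lemma coord_scale {R : realType} (c : R -> R) (p : R -> 'rV[R]_2) (i : 'I_2) :
  (fun u => (c u *: p u) 0 i) = (fun u => c u * p u 0 i).
Proof. by apply/funext => u; rewrite mxE. Qed.

Lemma curveW11_comb {R : realType} (t : R) (gamma v : R -> 'rV[R]_2) :
  curveW11 gamma -> curveW11 v ->
  curveW11 (fun u => gamma u + t *: v u) /\
  ae01 (fun u => cderiv (fun u => gamma u + t *: v u) u =
                 cderiv gamma u + t *: cderiv v u).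
Proof.
move=> Wg Wv.
have Pi i : primitive_of (fun u => (gamma u + t *: v u) 0 i)
    (fun u => cderiv gamma u 0 i + t * cderiv v u 0 i).
  rewrite coord_comb; under [X in primitive_of _ X]eq_fun do rewrite !mxE.
  exact: primitiveD (W11_primitive (Wg i)) (primitiveZ t (W11_primitive (Wv i))).
have ends i : (gamma 0 + t *: v 0) 0 i = (gamma 1 + t *: v 1) 0 i.
  by rewrite !mxE; have [_ -> _] := Wg i; have [_ -> _] := Wv i.
split; first by move=> i; exact: primitive_W11 (Pi i) (ends i).
have := ae01I (weak_deriv_ae (Pi ord0) (ends ord0))
              (weak_deriv_ae (Pi ord_max) (ends ord_max)).
apply: ae01S => u _ [e0 e1]; apply/rowP => i.
rewrite [LHS]mxE [RHS]mxE [X in _ + X]mxE.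
have [->|->] : i = ord0 \/ i = ord_max.
  by case: i => -[|[|//]] ?; [left|right]; exact/val_inj.
- exact: e0.
- exact: e1.
Qed.

Lemma clength_is_derive {R : realType} (gamma v : R -> 'rV[R]_2) :
  curveImm gamma -> curveW11 v ->
  is_derive (0 : R) (1 : R) (fun t : R => clength (fun u => gamma u + t *: v u))
    (int01 (fun u => dotp (cderiv gamma u) (cderiv v u) / enorm (cderiv gamma u))).
Proof.
move=> [Wg g0] Wv.
have ig i := curveW11_cderiv_integrable i Wg.
have iv i := curveW11_cderiv_integrable i Wv.
rewrite (_ : (fun t : R => _) =
    fun t => int01 (fun u => enorm (cderiv gamma u + t *: cderiv v u))).
  exact: int01_enorm_is_derive.
apply/funext => t; have [Wt te] := curveW11_comb t Wg Wv.
apply: int01_ae.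
- apply: enorm_meas => i.
  exact: integrable01_meas (curveW11_cderiv_integrable i Wt).
- apply: enorm_meas => i; apply: integrable01_meas; rewrite coord_comb.
  exact/integrable01D/integrable01Zl.
- by apply: ae01S te => u _ ->.
Qed.

Lemma clength_gt0 {R : realType} (gamma : R -> 'rV[R]_2) :
  curveImm gamma -> 0 < clength gamma.
Proof.
move=> [Wg g0].
have ie : integrable01 (fun u => enorm (cderiv gamma u)).
  by apply: enorm_integrable => i; exact: curveW11_cderiv_integrable.
have Lge0 : 0 <= clength gamma.
  by rewrite /clength /int01; apply: Rintegral_ge0 => u _; exact: enorm_ge0.
rewrite lt_def Lge0 andbT.
apply/eqP => L0.
have e0 := int01_ge0_eq0 ie (fun u _ => enorm_ge0 _) L0.
have [u _ [+ eu]] := ae01_witness_itv (lexx 0) ltr01 (lexx 1) (ae01I g0 e0).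
by rewrite eu ltxx.
Qed.

Lemma rho_primitive {R : realType} (gamma : R -> 'rV[R]_2) : curveImm gamma ->
  [/\ primitive_of (rho gamma) (fun u => enorm (cderiv gamma u) / clength gamma),
      rho gamma 0 = 0 & rho gamma 1 = 1].
Proof.
move=> Ig; have L0 := clength_gt0 Ig; case: Ig => Wg g0.
have ie : integrable01 (fun u => enorm (cderiv gamma u)).
  by apply: enorm_integrable => i; exact: curveW11_cderiv_integrable.
split.
- apply: primitive_ext (primitiveZ (clength gamma)^-1 (primitive_itg 0 ie)) => u _.
    by rewrite add0r.
  by rewrite mulrC.
- by rewrite /rho set_itv1 Rintegral_set1 mulr0.
- by rewrite /rho -/(int01 _) -/(clength gamma) mulVf// gt_eqF.
Qed.

Section gradient.
Context {R : realType}.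
Variables (lambda a : R) (gamma : R -> 'rV[R]_2).
Hypothesis lambda_gt0 : 0 < lambda.
Hypothesis gamma_imm : curveImm gamma.

Let L := clength gamma.
Let e u := enorm (cderiv gamma u).
Let k i u := gamma_conv gamma gamma (kernelG lambda) u 0 i.
Let C := L `^ (a - 2) / lambda ^+ 2.
Let h := length_gradient_formula lambda a gamma.

Let Wg : curveW11 gamma := gamma_imm.1.

Let L0 : 0 < L. Proof. exact: clength_gt0. Qed.

Let L1 : L != 0. Proof. by rewrite gt_eqF. Qed.

Let Pg i : primitive_of (fun u => gamma u 0 i) (fun u => cderiv gamma u 0 i).
Proof.
by under [X in primitive_of _ X]eq_fun do rewrite mxE; exact: W11_primitive.
Qed.

Let ie : integrable01 e.
Proof. by apply: enorm_integrable => i; exact: curveW11_cderiv_integrable. Qed.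

Let me : meas01 (fun u => (e u)^-1).
Proof.
apply: enormV_meas => i.
exact: integrable01_meas (curveW11_cderiv_integrable i Wg).
Qed.

Let hE i u : h u 0 i = C * (gamma u 0 i + k i u).
Proof. by rewrite /h /length_gradient_formula mxE [X in _ * X]mxE. Qed.

Let green i : exists m : R -> R,
  [/\ m 0 = m 1, k i 0 = k i 1, primitive_of (k i) (fun u => m u * (e u / L)) &
      primitive_of m (fun u => lambda ^- 2 * (k i u + gamma u 0 i) * (e u / L))].
Proof.
have [Pr r0 r1] := rho_primitive gamma_imm.
have w0 (u : R) : u \in `[0, 1] -> 0 <= e u / L.
  by move=> _; rewrite divr_ge0 ?enorm_ge0// ltW.
have [cg _ _] := Wg i.
have -> : k i = fun u => int01 (fun v =>
    gamma v 0 i * kernelG lambda (rho gamma v - rho gamma u) * (e v / L)).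
  by apply/funext => u; rewrite /k /gamma_conv mxE.
exact: green_solution lambda_gt0 Pr r0 r1 w0 cg.
Qed.

Lemma length_gradient_formula_W11 : curveW11 h.
Proof.
move=> i; have [m [_ k01 Pk _]] := green i.
rewrite (_ : (fun u => _) = fun u => C * (gamma u 0 i + k i u)); last first.
  by apply/funext => u; exact: hE.
apply: primitive_W11 (primitiveZ C (primitiveD (Pg i) Pk)) _.
by have [_ -> _] := Wg i; rewrite k01.
Qed.

(** Write [h = C (gamma + k)], of derivative [C (gamma' + m e / L)] with the
    Green function equations for [k] and [m].  The contribution of [gamma'] to
    the first order term is the asserted integral.  In the contribution of
    [m], integration by parts against [v'] turns [m] into
    [(gamma + k) / lambda ^ 2], and the constant [C] is the one for which it
    cancels the zeroth order term. *)
Lemma length_gradient_formula_metric (v : R -> 'rV[R]_2) : curveW11 v ->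
  H1_metric_defined gamma h v /\
  H1_metric lambda a gamma h v =
    int01 (fun u => dotp (cderiv gamma u) (cderiv v u) / enorm (cderiv gamma u)).
Proof.
move=> Wv; have Wh := length_gradient_formula_W11.
have [m mP] := choice green.
pose g i u := cderiv gamma u 0 i; pose v' i u := cderiv v u 0 i.
have Pv i : primitive_of (fun u => v u 0 i) (v' i).
  rewrite /v'; under [X in primitive_of _ X]eq_fun do rewrite mxE.
  exact: W11_primitive.
have cm i : {within `[0, 1], continuous (m i)}.
  by have [_ _ _ /primitive_continuous] := mP i.
have ck i : {within `[0, 1], continuous (k i)}.
  by have [_ _ /primitive_continuous] := mP i.
have cg i : {within `[0, 1], continuous (fun u => gamma u 0 i)} :=
  primitive_continuous (Pg i).
have cv i : {within `[0, 1], continuous (fun u => v u 0 i)} :=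
  primitive_continuous (Pv i).
have mg i : meas01 (g i) := integrable01_meas (Pg i).1.
have iv i : integrable01 (v' i) := (Pv i).1.
pose s i u := (gamma u 0 i + k i u) * v u 0 i * e u.
have is_ i : integrable01 (s i).
  apply: integrable01_continuousM ie => u; apply: cvgM; last exact: cv.
  by apply: cvgD; [exact: cg|exact: ck].
pose S := \sum_(i < 2) int01 (s i).
have d0E : H1_density0 gamma h v = fun u => C * \sum_(i < 2) s i u.
  apply/funext => u; rewrite /H1_density0 /dotp mulr_suml mulr_sumr.
  by apply: eq_bigr => i _; rewrite hE /s /e; ring.
have [iS IS] := int01_sum is_.
have i0 : integrable01 (H1_density0 gamma h v) by rewrite d0E; exact: integrable01Zl.
have I0 : int01 (H1_density0 gamma h v) = C * S by rewrite d0E int01Zl ?IS.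
pose A u := \sum_(i < 2) g i u / e u * v' i u.
pose B u := \sum_(i < 2) m i u * v' i u.
have iAi i : integrable01 (fun u => g i u / e u * v' i u).
  apply: (@integrable01_bounded _ 1) => //; first exact: measurable_funM.
  move=> u _; rewrite normrM normfV (ger0_norm (enorm_ge0 _ : 0 <= e u)).
  have [->|e0] := eqVneq (e u) 0; first by rewrite invr0 mulr0.
  rewrite ler_pdivrMr ?mul1r ?coord_le_enorm//.
  by rewrite lt_def e0 enorm_ge0.
have [iA IA] := int01_sum iAi.
have iBi i : integrable01 (fun u => m i u * v' i u) by exact: integrable01_continuousM.
have [iB IB] := int01_sum iBi.
have BS : int01 B = - (lambda ^- 2 / L * S).
  rewrite [LHS]IB /S mulr_sumr -sumrN; apply: eq_bigr => i _.
  have [m01 _ _ Pm] := mP i.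
  rewrite (primitive_by_parts Pm (Pv i)); last first.
    by rewrite m01; have [_ -> _] := Wv i.
  congr (- _); rewrite -int01Zl//; apply: eq_int01 => u _.
  by rewrite /s; ring.
have iAB : integrable01 (fun u => C * (A u + L^-1 * B u)).
  exact/integrable01Zl/integrable01D/integrable01Zl.
have d1E : ae01 (fun u => H1_density1 gamma h v u = C * (A u + L^-1 * B u)).
  have hd i : ae01 (fun u => cderiv h u 0 i = C * (g i u + m i u * (e u / L))).
    have [_ k01 Pk _] := mP i.
    have Ph : primitive_of (fun u => h u 0 i)
        (fun u => C * (g i u + m i u * (e u / L))).
      by apply: primitive_ext (primitiveZ C (primitiveD (Pg i) Pk)) => u _ //; rewrite hE.
    have h01 : h 0 0 i = h 1 0 i.
      apply: etrans (hE i 0) _; apply: etrans _ (esym (hE i 1)).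
      by rewrite k01; have [_ -> _] := Wg i.
    by apply: ae01S (weak_deriv_ae Ph h01) => u _ hu; rewrite mxE hu.
  apply: ae01S (ae01I gamma_imm.2 (ae01I (hd ord0) (hd ord_max))) => u _.
  move=> [eu [h0 h1]]; have e0 : e u != 0 by rewrite gt_eqF.
  rewrite /H1_density1 dotp2 /A /B !big_ord_recr/= !big_ord0 !add0r.
  rewrite (_ : widen_ord _ _ = ord0); last exact/val_inj.
  rewrite [(_ *: cderiv h u) 0 ord0]mxE [(_ *: cderiv h u) 0 ord_max]mxE h0 h1.
  rewrite [(_ *: cderiv v u) 0 ord0]mxE [(_ *: cderiv v u) 0 ord_max]mxE.
  by rewrite -/(e u) -/(v' _ _) -/(v' _ _); field; rewrite e0 L1.
have m1 : meas01 (H1_density1 gamma h v).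
  apply: measurable_funM; last exact: integrable01_meas ie.
  apply: measurable_sum => i; apply: measurable_funM.
    rewrite coord_scale; apply: measurable_funM => //.
    exact: integrable01_meas (curveW11_cderiv_integrable i Wh).
  rewrite coord_scale; apply: measurable_funM => //.
  exact: integrable01_meas (curveW11_cderiv_integrable i Wv).
have i1 := integrable01_ae m1 d1E iAB.
split; first by split.
rewrite /H1_metric I0 (int01_ae m1 (integrable01_meas iAB) d1E).
rewrite int01Zl ?int01D ?int01Zl//;
  [|exact: integrable01Zl|exact/integrable01D/integrable01Zl].
rewrite BS (_ : int01 (fun u => dotp _ _ / _) = int01 A); last first.
  apply: eq_int01 => u _; rewrite /dotp mulr_suml; apply: eq_bigr => i _.
  by rewrite /g /v' /e; ring.
rewrite -/L; have -> : L `^ a = L `^ (a - 2) * L ^+ 2.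
  by rewrite -powR_mulrn ?ltW// -powRD ?subrK// L1 implybT.
have X0 : L `^ (a - 2) != 0 by rewrite gt_eqF// powR_gt0.
rewrite /C; move: (L `^ (a - 2)) X0 => X X0.
by field; rewrite X0 L1 gt_eqF.
Qed.

Lemma length_gradient_formula_gradient : is_length_gradient lambda a gamma h.
Proof.
split=> [|v Wv]; first exact: length_gradient_formula_W11.
have [def ->] := length_gradient_formula_metric Wv.
by split=> //; exact: clength_is_derive.
Qed.

End gradient.

(** The difference [z] of two gradients lies in W^{1,1}, so it is an admissible
    direction.  Both gradients pair with [z] to the same number, which makes
    the squared norm of [z] vanish; its zeroth order part already forces
    [z = 0] almost everywhere, hence everywhere by continuity. *)
Lemma length_gradient_unique {R : realType} (lambda a : R)
    (gamma h1 h2 : R -> 'rV[R]_2) : 0 < lambda -> curveImm gamma ->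
  is_length_gradient lambda a gamma h1 -> is_length_gradient lambda a gamma h2 ->
  forall u : R, u \in `[0, 1] -> h1 u = h2 u.
Proof.
move=> l0 Ig [W1 G1] [W2 G2].
have L0 := clength_gt0 Ig.
pose z u := h1 u + (- 1) *: h2 u.
have [Wz dz] := curveW11_comb (- 1) W1 W2.
have [[i10 i11] d1] := G1 z Wz; have [[i20 i21] d2] := G2 z Wz.
pose e u := enorm (cderiv gamma u).
pose s u := dotp (z u) (z u) * e u.
have is_ : integrable01 s.
  apply: eq_integrable (integrable01B i10 i20) => // u _ /=.
  rewrite /s /H1_density0 !dotp2 /z -/(e u) !mxE; congr EFin; ring.
have Is : int01 s = int01 (H1_density0 gamma h1 z) - int01 (H1_density0 gamma h2 z).
  rewrite -int01B//; apply: eq_int01 => u _.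
  by rewrite /s /H1_density0 !dotp2 /z -/(e u) !mxE; ring.
have s0 (u : R) : u \in `[0, 1] -> 0 <= s u.
  by move=> _; rewrite mulr_ge0 ?dotp_ge0 ?enorm_ge0.
have J0 : 0 <= int01 (H1_density1 gamma h1 z) - int01 (H1_density1 gamma h2 z).
  rewrite -int01B//.
  pose r u := H1_density1 gamma h1 z u - H1_density1 gamma h2 z u.
  have ir : integrable01 r by exact: integrable01B.
  (* The derivative of [z] is the difference of the derivatives only almost
     everywhere, so [r] is compared with its absolute value. *)
  have rn : ae01 (fun u => r u = `|r u|).
    apply: ae01S dz => u _ zu; rewrite ger0_norm// /r /H1_density1 zu -/(e u).
    rewrite -mulrBl mulr_ge0 ?enorm_ge0//.
    set b := (e u)^-1; set x := cderiv h1 u; set y := cderiv h2 u.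
    rewrite [leRHS](_ : _ =
      dotp (b *: (x + -1 *: y)) (b *: (x + -1 *: y))) ?dotp_ge0//.
    by rewrite !dotp2 !mxE; ring.
  rewrite -/(int01 r) (int01_ae (integrable01_meas ir) _ rn).
    by rewrite /int01; apply: Rintegral_ge0 => u _; exact: normr_ge0.
  exact: integrable01_meas (integrable01_norm ir).
have S0 : 0 <= int01 s by rewrite /int01; exact: Rintegral_ge0.
have S1 : int01 s = 0.
  have := etrans (esym (@derive_val _ _ _ _ _ _ _ d1))
    (@derive_val _ _ _ _ _ _ _ d2).
  have : 0 < (clength gamma `^ a)^-1 by rewrite invr_gt0 powR_gt0.
  have : 0 <= lambda ^+ 2 / clength gamma `^ (a - 2).
    by rewrite divr_ge0 ?sqr_ge0// powR_ge0.
  move: S0 J0; rewrite Is /H1_metric.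
  move: (int01 (H1_density0 gamma h1 z)) (int01 (H1_density0 gamma h2 z)).
  move: (int01 (H1_density1 gamma h1 z)) (int01 (H1_density1 gamma h2 z)).
  move: (_^-1) (_ / _) => p q B B' A A' S0 J0 q0 p0 E.
  have : p * (A - A') = 0.
    have := mulr_ge0 q0 J0; have := mulr_ge0 (ltW p0) S0; move: E; lra.
  by move=> /eqP; rewrite mulf_eq0 gt_eqF//= => /eqP.
have z0 := int01_ge0_eq0 is_ s0 S1.
have zi i (u : R) : u \in `[0, 1] -> z u 0 i = 0.
  apply: (@continuous01_ae_eq0 _ (fun u => z u 0 i)); first by have [] := Wz i.
  apply: ae01S (ae01I Ig.2 z0) => v _ [ev /eqP].
  rewrite mulf_eq0 (gt_eqF ev) orbF => /eqP dv.
  have := coord_le_enorm (z v) i.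
  by rewrite /enorm dv sqrtr0 normr_le0 => /eqP.
move=> u u01; apply/rowP => i; have := zi i u u01.
by rewrite /z !mxE mulN1r => /subr0_eq.
Qed.

Theorem lemma2p1 (R : realType) (lambda a : R) (gamma : R -> 'rV[R]_2)
    (lambda_gt0 : 0 < lambda) (gamma_imm : curveImm gamma) :
  is_length_gradient lambda a gamma (length_gradient_formula lambda a gamma) /\
  (forall h : R -> 'rV[R]_2, is_length_gradient lambda a gamma h ->
     forall u : R, 0 <= u <= 1 ->
       h u = length_gradient_formula lambda a gamma u).
Proof.
have Gf := length_gradient_formula_gradient a lambda_gt0 gamma_imm.
split=> [//|h Gh u u01].
by apply: (length_gradient_unique lambda_gt0 gamma_imm Gh Gf); rewrite in_itv.
Qed.
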